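(* Let $K$ be a field, $R=K[x_0,\dots,x_N]=K[\mathbf{P}^N]$ and $M=(x_0,\dots,x_N)$. Let $p_1,\dots,p_n\in\mathbf{P}^N$ be distinct points, let $J=\bigcap_i I(p_i)\subset R$, let $m\ge 1$ and let $I=J^{(m)}$. If $N=2$ and if $J$ is generated in degree $\alpha(J)$ (i.e., by homogeneous elements all of degree $\alpha(J)$), then $I^{(Nr)}\subseteq M^{r(N-1)}I^r$ for all $r\ge 1$.
   Context: For a point $p\in\mathbf{P}^N$ (a $K$-rational point), $I(p)\subset R$ is the ideal generated by all forms vanishing at $p$. For $J=\bigcap_i I(p_i)$ with distinct $p_i$, the $m$-th symbolic power is $J^{(m)}=\bigcap_i I(p_i)^m$, and for $I=J^{(m)}$ one has $I^{(k)}=J^{(mk)}=\bigcap_i I(p_i)^{mk}$. For a nonzero homogeneous ideal $J$, $\alpha(J)$ is the smallest integer $l$ such that the degree-$l$ component $J_l$ is nonzero. *)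

(* Defs.v *)
From HB Require Import structures.
From mathcomp Require Import all_boot all_order all_algebra.
From mathcomp Require Import boolp classical_sets.
From mathcomp Require Import mpoly.

Set Implicit Arguments.
Unset Strict Implicit.
Unset Printing Implicit Defensive.

Import Order.TTheory GRing.Theory.

Local Open Scope classical_set_scope.
Local Open Scope ring_scope.

(* MathComp's [idealr] only covers proper, decidable ideals; here an ideal is
   a classical set, and the whole ring is allowed. *)
Section Ideals.
Variable R : comNzRingType.

Definition is_ideal (A : set R) : Prop :=
  [/\ A 0, forall f g, A f -> A g -> A (f + g) & forall f g, A g -> A (f * g)].

Definition ideal_gen (G : set R) : set R := smallest is_ideal G.

Definition ideal_mul (A B : set R) : set R :=
  ideal_gen [set f * g | f in A & g in B].

Definition ideal_exp (A : set R) (k : nat) : set R :=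
  iter k (ideal_mul A) [set: R].

End Ideals.

Section Forms.
Variables (K : fieldType) (n : nat).

Definition irrelevant_ideal : set {mpoly K[n]} :=
  ideal_gen (range (fun i : 'I_n => 'X_i : {mpoly K[n]})).

Definition has_form (J : set {mpoly K[n]}) (l : nat) : Prop :=
  exists f, [/\ J f, f != 0 & f \is l.-homog].

(* The junk value is 0 when J contains no nonzero form; a nonzero homogeneous
   ideal always contains one. *)
Definition alpha (J : set {mpoly K[n]}) : nat :=
  xget 0%N [set l | has_form J l /\ forall k, has_form J k -> (l <= k)%N].

Definition generated_in_degree (J : set {mpoly K[n]}) (d : nat) : Prop :=
  exists G : set {mpoly K[n]},
    (forall f, G f -> f \is d.-homog) /\ J = ideal_gen G.

End Forms.

Arguments irrelevant_ideal : clear implicits.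

(* Points of P^N are given by nonzero vectors of homogeneous coordinates. *)
Section Points.
Variables (K : fieldType) (N : nat).

Definition same_point (u v : 'rV[K]_N.+1) : Prop :=
  exists2 c : K, c != 0 & v = c *: u.

Definition point_ideal (v : 'rV[K]_N.+1) : set {mpoly K[N.+1]} :=
  ideal_gen [set f | (exists d, f \is d.-homog) /\ f.@[v ord0] = 0].

Definition points_ideal (n : nat) (p : 'I_n -> 'rV[K]_N.+1) :
    set {mpoly K[N.+1]} :=
  \bigcap_i point_ideal (p i).

(* The k-th symbolic power J^(k) of J = points_ideal p. The k-th symbolic power
   of J^(m) itself is J^(m * k). *)
Definition points_symb (n : nat) (p : 'I_n -> 'rV[K]_N.+1) (k : nat) :
    set {mpoly K[N.+1]} :=
  \bigcap_i ideal_exp (point_ideal (p i)) k.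

End Points.

(* Main.v *)
(* Put k = r m. Since J^(m) contains J^m, it suffices to show that the symbolic
   power J^(2k) lies in M^k J^k.

   In characteristic l > 0 this is the argument of Hochster and Huneke. Let q be
   a power of l, q = a k + r with r < k, f a form in J^(2k) and g a generator of
   J. Then f^a g^(2r) lies in J^(2q), hence in the Frobenius power J^[q], because
   near a point of the plane the ideal is generated by two elements and Frobenius
   is flat. Consequently g^(2k^2) f^q lies in (J^k)^[q] for all q, and flatness
   gives f in J^k as soon as q exceeds the degree of g^(2k^2). If moreover
   deg f < k (alpha + 1), then for large q the form f^a g^(2r) is a combination of
   q-th powers of forms of degree alpha in J with coefficients of degree < q; this
   forces those forms to lie in J^(2), so their derivatives lie in J and vanish by
   degree, so they are l-th powers of forms in J of smaller degree, a
   contradiction. Hence deg f >= k (alpha + 1), which gives the factor M^k.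

   An arbitrary field is reduced to an algebraically closed one of positive
   characteristic by specializing a finitely generated subring. That J is the full
   ideal of the points is preserved because it is witnessed by finitely many
   interpolation identities, and f not in J^k is witnessed by a linear functional. *)

Require Import Defs.
From HB Require Import structures.
From mathcomp Require Import all_boot all_order all_algebra all_field.
From mathcomp Require Import boolp classical_sets.
From mathcomp Require Import mpoly ring zify.

Set Implicit Arguments.
Unset Strict Implicit.
Unset Printing Implicit Defensive.

Import Order.TTheory GRing.Theory.

Local Open Scope classical_set_scope.
Local Open Scope ring_scope.

(** * Specialization to positive characteristic *)

Lemma minimal_witness (T : Type) (P : T -> Prop) (s : T -> nat) :
  (exists x, P x) -> exists2 x, P x & forall y, P y -> (s x <= s y)%N.
Proof.
move=> [x0 Px0].
have ex : exists k, `[< exists2 x, P x & s x = k >].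
  by exists (s x0); apply/asboolP; exists x0.
have [k /asboolP [x Px sx] mink] := ex_minnP ex.
exists x => // y Py; rewrite sx; apply: mink.
by apply/asboolP; exists y.
Qed.

(* The inequation [phi delta != 0] is what makes the induction on the number of
   generators of the subring go through. *)
Definition specializable (A : comNzRingType) (K : fieldType)
    (iota : {rmorphism A -> K}) : Prop :=
  forall delta, iota delta != 0 ->
    exists (l : nat) (W : closedFieldType) (phi : {rmorphism A -> W}),
      [/\ l \in [pchar W], forall x, iota x = 0 -> phi x = 0 &
          phi delta != 0].

(** The ring [{poly A}] with this map stands for the subring of [K] generated by the image of [A]
    and by [a]; since [iota] may have a kernel, no quotient has to be formed. *)
Definition eval_map (A : comNzRingType) (K : fieldType)
    (iota : {rmorphism A -> K}) (a : K) : {rmorphism {poly A} -> K} :=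
  horner_eval a \o map_poly iota.

Lemma eval_mapE (A : comNzRingType) (K : fieldType)
    (iota : {rmorphism A -> K}) (a : K) (P : {poly A}) :
  eval_map iota a P = (map_poly iota P).[a].
Proof. by []. Qed.

(** The target is an algebraic closure of a prime field: its characteristic is that of [K] when
    positive, and otherwise a prime exceeding [|d|]. *)
Lemma specializable_int (K : fieldType) (iota : {rmorphism int -> K}) :
  specializable iota.
Proof.
move=> d iotad.
have [l lpr [kerl ld]] : exists2 l, prime l &
    (forall x : int, iota x = 0 -> (l %| x)%Z) /\ ~~ (l %| d)%Z.
  have iotaE (x : int) : iota x = x%:~R by rewrite -[x]intz rmorph_int intz.
  have iota_abs (x : int) : (iota x == 0) = (`|x|%N%:R == 0 :> K).
    rewrite iotaE [in LHS](intEsign x) rmorphM /= mulf_eq0 rmorph_sign.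
    by rewrite signr_eq0.
  have [[l lK]|noK] := pselect (exists l, l \in [pchar K]).
    exists l; first by case/andP: lK.
    split=> [x /eqP|]; first by rewrite iota_abs -(dvdn_pcharf lK) dvdzE.
    by move: iotad; rewrite iota_abs -(dvdn_pcharf lK) dvdzE.
  have [l dl lpr] := prime_above `|d|%N.
  exists l => //; split=> [x /eqP|].
    rewrite iota_abs; have ch0 : [pchar K] =i pred0.
      by move=> r; apply/negP => rK; apply: noK; exists r.
    by rewrite pcharf0P in ch0; rewrite ch0 absz_eq0 => /eqP ->; apply: dvdz0.
  rewrite dvdzE /=; apply/negP => /dvdn_leq.
  rewrite absz_gt0 leqNgt dl => H; suff: false by []; apply: H.
  by apply: contraNneq iotad => ->; rewrite rmorph0.
have [W [f _]] := countable_algebraic_closure 'F_l.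
have lW : l \in [pchar W] by rewrite (fmorph_pchar f) pchar_Fp.
exists l, (W : closedFieldType), (intr : {rmorphism int -> W}).
have cast0 (x : int) : (x%:~R == 0 :> W) = (l %| x)%Z.
  rewrite (intEsign x) rmorphM /= mulf_eq0 rmorph_sign signr_eq0 /=.
  by rewrite -(dvdn_pcharf lW) dvdzE abszMsign.
split=> // [x /kerl lx|]; last by rewrite cast0.
by apply/eqP; rewrite cast0.
Qed.

Section AdjoinOne.
Variables (A : comNzRingType) (K : fieldType) (iota : {rmorphism A -> K}).
Variable a : K.
Local Notation "P ^i" := (map_poly iota P) (at level 2, format "P ^i").

(** Dropping the top coefficients killed by [iota] makes the degree over [A] agree with the degree
    over [K], so that degrees can be compared by minimality. *)
Lemma truncate_map (P : {poly A}) :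
  P^i != 0 -> exists Q : {poly A},
    [/\ Q^i = P^i, iota (lead_coef Q) != 0 & size Q = size P^i].
Proof.
move=> Pn0; pose Q := \poly_(k < size P^i) P`_k.
have sQ : size Q = size P^i.
  apply: size_poly_eq; apply: contraNneq Pn0 => H.
  by rewrite -lead_coef_eq0 lead_coefE coef_map /= H rmorph0.
exists Q; split => //.
  apply/polyP => k; rewrite coef_map coef_poly coef_map /=.
  by case: ltnP => // h; rewrite rmorph0 -coef_map nth_default.
rewrite lead_coefE sQ coef_poly prednK ?size_poly_gt0 // leqnn.
by rewrite -coef_map -lead_coefE lead_coef_eq0.
Qed.

Lemma pseudo_div (Q P : {poly A}) : P != 0 ->
  exists e S R, lead_coef P ^+ e *: Q = S * P + R /\ (size R < size P)%N.
Proof.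
move=> Pn0; exists (Pdiv.CommonRing.rscalp Q P), (Pdiv.CommonRing.rdivp Q P),
  (Pdiv.CommonRing.rmodp Q P).
by rewrite Pdiv.ComRing.rdivp_eq Pdiv.CommonRing.ltn_rmodp.
Qed.

(** It suffices to keep alive the coefficient of [D] that becomes leading over [K]: the image of [D]
    is then a nonzero polynomial, and [X] can be sent to a point that is not a root of it. *)
Lemma specializable_transcendental :
  (forall P : {poly A}, P^i.[a] = 0 -> P^i = 0) ->
  specializable iota -> specializable (eval_map iota a).
Proof.
move=> tr sp D; rewrite eval_mapE => Da.
have : D^i != 0 by apply: contraNneq Da => ->; rewrite horner0.
rewrite -lead_coef_eq0 lead_coefE coef_map /= => /sp [l [W [phi [lW ker Dk]]]].
have : map_poly phi D != 0.
  by apply: contraNneq Dk => H; rewrite -coef_map H coef0.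
move=> /closed_nonrootP [x xP].
exists l, W, (eval_map phi x); split => // P.
rewrite !eval_mapE => /tr P0.
suff -> : map_poly phi P = 0 by rewrite horner0.
apply/polyP => k; rewrite coef_map coef0 /= ker //.
by rewrite -coef_map P0 coef0.
Qed.

(** The element [a] goes to a root of the image of a polynomial [P] of least degree that vanishes at
    [a]. Pseudo-division by [P] shows that every relation satisfied by [a] survives once the leading
    coefficient of [P] does. *)
Lemma specializable_algebraic (P0 : {poly A}) :
  P0^i.[a] = 0 -> P0^i != 0 ->
  specializable iota -> specializable (eval_map iota a).
Proof.
move=> P0a P0n0 sp D; rewrite eval_mapE => Da.
have [P [Pa Pl] minP] : exists2 P : {poly A},
    P^i.[a] = 0 /\ iota (lead_coef P) != 0 &
    forall Q : {poly A}, Q^i.[a] = 0 /\ iota (lead_coef Q) != 0 ->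
      (size P <= size Q)%N.
  apply: minimal_witness; have [Q [Q1 Q2 _]] := truncate_map P0n0.
  by exists Q; rewrite Q1.
have lt0 (Q : {poly A}) : (size Q < size P)%N -> Q^i.[a] = 0 -> Q^i = 0.
  move=> sQ Qa; apply/eqP; apply: contraTT sQ => Qn0; rewrite -leqNgt.
  have [Q' [Q1 Q2 Q3]] := truncate_map Qn0.
  apply: (@leq_trans (size Q')); first by apply: minP; rewrite Q1.
  by rewrite Q3 size_poly.
have Pn0 : P != 0.
  by apply: contraNneq Pl => ->; rewrite lead_coef0 rmorph0.
have evZ c (Q : {poly A}) : (c *: Q)^i.[a] = iota c * Q^i.[a].
  by rewrite map_polyZ hornerZ.
have evMD (S Q R : {poly A}) :
    (S * Q + R)^i.[a] = S^i.[a] * Q^i.[a] + R^i.[a].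
  by rewrite rmorphD rmorphM /= hornerD hornerM.
(* A multiple T of D of minimal degree with T(a) <> 0 is a constant t: it is
   then enough not to kill t and the leading coefficient of P. *)
pose multD (T : {poly A}) := exists U : {poly A}, T^i.[a] = U^i.[a] * D^i.[a].
have [T [Tl [Ta [U TU]]] minT] : exists2 T : {poly A},
    iota (lead_coef T) != 0 /\ T^i.[a] != 0 /\ multD T &
    forall Q : {poly A},
      iota (lead_coef Q) != 0 /\ Q^i.[a] != 0 /\ multD Q ->
      (size T <= size Q)%N.
  apply: minimal_witness.
  have /truncate_map [Q [Q1 Q2 _]] : D^i != 0.
    by apply: contraNneq Da => ->; rewrite horner0.
  by exists Q; rewrite /multD Q1; split=> //; split=> //; exists 1;
    rewrite rmorph1 hornerC mul1r.
have minT' (R : {poly A}) : (size R < size T)%N -> multD R -> R^i.[a] = 0.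
  move=> sR mR; apply/eqP; apply: contraTT sR => Ra; rewrite -leqNgt.
  have /truncate_map [Q [Q1 Q2 Q3]] : R^i != 0.
    by apply: contraNneq Ra => ->; rewrite horner0.
  apply: (@leq_trans (size Q)); last by rewrite Q3 size_poly.
  by apply: minT; rewrite /multD Q1.
have Tn0 : T != 0.
  by apply: contraNneq Tl => ->; rewrite lead_coef0 rmorph0.
(* The pseudo-remainder of [D] by [P] takes at [a] a nonzero multiple of the value of [D], so it
   competes with [T]. *)
have sTP : (size T < size P)%N.
  have [e [S [R [eq sR]]]] := pseudo_div D Pn0.
  have Rv : R^i.[a] = iota (lead_coef P ^+ e) * D^i.[a].
    by rewrite -evZ eq evMD Pa mulr0 add0r.
  have Rn : R^i.[a] != 0 by rewrite Rv mulf_neq0 // rmorphXn expf_neq0.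
  rewrite ltnNge; apply/negP => sPT; move/eqP: Rn; apply.
  apply: minT'; first exact: leq_trans sR sPT.
  by exists (lead_coef P ^+ e)%:P; rewrite Rv map_polyC hornerC.
(* Otherwise pseudo-divide [P] by [T]. The remainder vanishes at [a] by minimality of [T], hence is
   zero over [K]; the quotient then vanishes at [a] and has smaller degree than [P]. *)
have sT1 : (size T <= 1)%N.
  have [e [S [R [eq sR]]]] := pseudo_div P Tn0.
  rewrite leqNgt; apply/negP => sT.
  have evPQ : S^i.[a] * T^i.[a] + R^i.[a] = 0 by rewrite -evMD -eq evZ Pa mulr0.
  have Ra : R^i.[a] = 0.
    apply: minT' => //; exists (- S * U); rewrite rmorphM rmorphN /=.
    rewrite hornerM hornerN -mulrA -TU mulNr; apply/eqP.
    by rewrite -addr_eq0 addrC evPQ.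
  have R0 : R^i = 0 by apply: lt0 => //; exact: ltn_trans sR sTP.
  have Sa : S^i.[a] = 0.
    by apply/eqP; move/eqP: evPQ; rewrite Ra addr0 mulf_eq0 (negPf Ta) orbF.
  have e2 : iota (lead_coef T) ^+ e *: P^i = S^i * T^i.
    by rewrite -[RHS]addr0 -R0 -rmorphXn -map_polyZ eq rmorphD rmorphM.
  have Sn0 : S^i != 0.
    apply: contraNneq Pl => S0; move/eqP: e2.
    rewrite S0 mul0r scaler_eq0 expf_eq0 (negPf Tl) andbF /=.
    by move=> /eqP H; rewrite lead_coefE -coef_map H coef0.
  have [S' [S1 S2 S3]] := truncate_map Sn0.
  have : (size P <= size S')%N by apply: minP; rewrite S1.
  have := congr1 (fun u : {poly K} => size u) e2.
  rewrite size_scale ?expf_neq0 // size_mul //; last first.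
    by apply: contraNneq Ta => ->; rewrite horner0.
  have sPi : size P^i = size P by exact: size_map_poly_id0.
  rewrite sPi S3 => ->.
  have -> : size T^i = size T by exact: size_map_poly_id0.
  by move: sT; clear; move: (size T) (size S^i) => u v; lia.
have [t Tt] : exists t, T = t%:P by exists T`_0; apply: size1_polyC.
have td : iota t * iota (lead_coef P) != 0.
  by rewrite mulf_neq0 //; move: Ta; rewrite Tt map_polyC hornerC.
have := sp (t * lead_coef P); rewrite rmorphM => /(_ td) [l [W [phi [lW ker]]]].
rewrite rmorphM mulf_eq0 negb_or => /andP [phit phiP].
have sPphi : size (map_poly phi P) = size P by exact: size_map_poly_id0.
have sP1 : size P != 1.
  apply/negP => /eqP /eqP /size_poly1P [c cn0 Pc]; move: Pl Pa.
  by rewrite Pc lead_coefC map_polyC hornerC => /eqP.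
have /closed_rootP [x /eqP xP] : size (map_poly phi P) != 1 by rewrite sPphi.
have kerP (Q : {poly A}) : Q^i.[a] = 0 -> (map_poly phi Q).[x] = 0.
  move=> Qa; have [e [S [R [eq sR]]]] := pseudo_div Q Pn0.
  have Ra : R^i.[a] = 0.
    by have := congr1 (fun u : {poly A} => u^i.[a]) eq;
      rewrite evZ evMD Qa Pa !mulr0 add0r.
  have R0 := lt0 _ sR Ra.
  have Rp : map_poly phi R = 0.
    apply/polyP => k; rewrite coef_map coef0 /= ker //.
    by rewrite -coef_map R0 coef0.
  have := congr1 (fun u : {poly A} => (map_poly phi u).[x]) eq.
  rewrite map_polyZ hornerZ rmorphD rmorphM /= hornerD hornerM xP Rp horner0.
  rewrite mulr0 addr0 rmorphXn => /eqP; rewrite mulf_eq0 expf_eq0.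
  by rewrite (negPf phiP) andbF => /eqP.
exists l, W, (eval_map phi x); split=> //; rewrite eval_mapE.
(* [T - U * D] vanishes at [a], hence at [x]; were [D] to vanish at [x] too, the constant [t] would
   be killed. *)
apply: contraNneq phit => D0.
have : (T - U * D)^i.[a] = 0.
  by rewrite rmorphB rmorphM /= hornerD hornerN hornerM TU subrr.
move/kerP; rewrite rmorphB rmorphM /= hornerD hornerN hornerM D0 mulr0 subr0.
by rewrite Tt map_polyC hornerC => ->.
Qed.

Lemma specializable_adjoin :
  specializable iota -> specializable (eval_map iota a).
Proof.
have [[P [Pa Pn0]]|no] := pselect (exists P, P^i.[a] = 0 /\ P^i != 0).
  exact: specializable_algebraic Pa Pn0.
apply: specializable_transcendental => P Pa; apply/eqP.
by apply: contrapT => /negP Pn0; apply: no; exists P.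
Qed.

End AdjoinOne.

Lemma exists_specialization (K : fieldType) (s : seq K) :
  exists (l : nat) (W : closedFieldType) (A : comNzRingType)
    (iota : {rmorphism A -> K}) (phi : {rmorphism A -> W}),
    [/\ l \in [pchar W], forall x, iota x = 0 -> phi x = 0 &
        forall a, a \in s -> exists x, iota x = a].
Proof.
have [A [iota [sp im]]] : exists (A : comNzRingType)
    (iota : {rmorphism A -> K}), specializable iota /\
    forall a, a \in s -> exists x, iota x = a.
  elim: s => [|a s [A [iota [sp im]]]].
    by exists int, intr; split=> //; apply: specializable_int.
  exists {poly A}, (eval_map iota a); split; first exact: specializable_adjoin.
  move=> b; rewrite inE => /orP [/eqP ->|/im [x <-]].
    by exists 'X; rewrite eval_mapE map_polyX hornerX.
  by exists x%:P; rewrite eval_mapE map_polyC hornerC.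
have [|l [W [phi [lW ker _]]]] := sp 1; first by rewrite rmorph1 oner_neq0.
by exists l, W, A, iota, phi.
Qed.

(** * Multiplicity at a point *)

Section VanishingOrder.
Variables (N : nat) (R : comNzRingType).
Implicit Types (j : 'I_N) (m w : 'X_{1..N}) (y z : {mpoly R[N]}).

(** The variables other than the [j]-th are the local coordinates at the [j]-th coordinate point, so
    this is the order of vanishing of the monomial there. *)
Definition off_degree j m : nat := (\sum_(i < N | i != j) m i)%N.

(* For a point with P j = 1, the multiplicity of y at P is at least k if and only
   if [vanishing_order j k (shift j P y)], with [shift] defined below. *)
Definition vanishing_order j (k : nat) y : Prop :=
  {in msupp y, forall m, (k <= off_degree j m)%N}.

Lemma homog_mdeg d y m : y \is d.-homog -> m \in msupp y -> mdeg m = d.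
Proof. by move/dhomogP => h /h. Qed.

Lemma off_degreeD j m w :
  off_degree j (m + w)%MM = (off_degree j m + off_degree j w)%N.
Proof. by rewrite /off_degree -big_split; apply: eq_bigr => i _; rewrite mnmDE. Qed.

Lemma off_degreeMn j m k : off_degree j (m *+ k)%MM = (off_degree j m * k)%N.
Proof.
by rewrite /off_degree big_distrl; apply: eq_bigr => i _; rewrite mulmnE.
Qed.

Lemma mdeg_off_degree j m : mdeg m = (m j + off_degree j m)%N.
Proof. by rewrite mdegE (bigD1 j). Qed.

Lemma vanishing_order0 j k : vanishing_order j k 0.
Proof. by move=> m; rewrite mcoeff_msupp mcoeff0 eqxx. Qed.

Lemma vanishing_orderD j k y z :
  vanishing_order j k y -> vanishing_order j k z -> vanishing_order j k (y + z).
Proof. by move=> vy vz m /msuppD_le; rewrite mem_cat => /orP[/vy|/vz]. Qed.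

Lemma vanishing_order_sum j k (I : Type) (r : seq I) (P : pred I)
    (F : I -> {mpoly R[N]}) :
  (forall i, P i -> vanishing_order j k (F i)) ->
  vanishing_order j k (\sum_(i <- r | P i) F i).
Proof.
move=> vF; elim/big_rec: _ => [|i y Pi vy]; first exact: vanishing_order0.
by apply: vanishing_orderD => //; apply: vF.
Qed.

Lemma vanishing_orderM j k1 k2 y z :
  vanishing_order j k1 y -> vanishing_order j k2 z ->
  vanishing_order j (k1 + k2) (y * z).
Proof.
move=> vy vz m /msuppM_le /allpairsP [[m1 m2] /= [/vy h1 /vz h2 ->]].
by rewrite off_degreeD leq_add.
Qed.

Lemma vanishing_orderMl j k y z :
  vanishing_order j k z -> vanishing_order j k (y * z).
Proof. by move=> vz; rewrite -[k]add0n; apply: vanishing_orderM. Qed.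

Lemma vanishing_orderXn j k a y :
  vanishing_order j k y -> vanishing_order j (a * k) (y ^+ a).
Proof.
move=> vy; elim: a => [|a IH]; first by [].
by rewrite exprS mulSn; apply: vanishing_orderM.
Qed.

Definition axis_point j : 'I_N -> R := fun i => (i == j)%:R.

Lemma vanishing_order1_meval j y :
  vanishing_order j 1 y -> y.@[axis_point j] = 0.
Proof.
move=> vy; rewrite mevalE big_seq big1 // => m /vy.
rewrite lt0n sum_nat_eq0 => /forall_inPn [i ij mi].
by rewrite (bigD1 i) //= /axis_point (negPf ij) expr0n (negPf mi) mul0r mulr0.
Qed.

(** The only monomial of degree [d] with off-degree zero is the [d]-th power of the [j]-th variable,
    and its coefficient is the value of [y] at the coordinate point. *)
Lemma meval_vanishing_order1 j d y :
  y \is d.-homog -> y.@[axis_point j] = 0 -> vanishing_order j 1 y.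
Proof.
move=> hy y0 m my; rewrite lt0n; apply/negP => /eqP offm.
have mE w : w \in msupp y -> off_degree j w = 0%N -> w = m.
  move=> wy offw; apply/mnmP => i.
  have offE (u : 'X_{1..N}) : off_degree j u = 0%N -> forall i, i != j -> u i = 0%N.
    move=> /eqP; rewrite sum_nat_eq0 => /forall_inP H i' /H /eqP; exact.
  have [->|ij] := eqVneq i j; last by rewrite !offE.
  have := homog_mdeg hy my; rewrite -(homog_mdeg hy wy).
  by rewrite !(mdeg_off_degree j) offm offw !addn0.
move: y0; rewrite mevalE (bigD1_seq m) ?msupp_uniq //=.
rewrite [X in _ + X]big1_seq ?addr0; last first.
  move=> w /andP [wm wy].
  have : off_degree j w != 0%N by apply: contraNneq wm => /mE ->.
  rewrite sum_nat_eq0 => /forall_inPn [i ij wi].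
  by rewrite (bigD1 i) //= /axis_point (negPf ij) expr0n (negPf wi) mul0r mulr0.
rewrite big1 ?mulr1 => [|i _].
  by move=> y0; move: my; rewrite mcoeff_msupp y0 eqxx.
rewrite /axis_point; have [->|ij] := eqVneq i j; first by rewrite expr1n.
by move/eqP: offm; rewrite sum_nat_eq0 => /forall_inP /(_ _ ij) /eqP ->.
Qed.

(** * Linear coordinates centred at a point *)

Definition shift_tuple j (P : 'I_N -> R) : N.-tuple {mpoly R[N]} :=
  [tuple if i == j then 'X_j else 'X_i + P i *: 'X_j | i < N].

(** When [P j = 1], this is the pullback along a linear automorphism carrying the [j]-th coordinate
    point to [P]; linearity preserves degrees. *)
Definition shift j P y : {mpoly R[N]} := y \mPo shift_tuple j P.

HB.instance Definition _ j P := GRing.RMorphism.copy (shift j P)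
  (comp_mpoly (shift_tuple j P)).

Lemma shiftX j P m :
  shift j P 'X_[m] =
  \prod_(i < N) (if i == j then 'X_j else 'X_i + P i *: 'X_j) ^+ m i.
Proof. by rewrite /shift comp_mpolyX; apply: eq_bigr => i _; rewrite tnth_mktuple. Qed.

Lemma shiftXU j P i :
  shift j P 'X_i = if i == j then 'X_j else 'X_i + P i *: 'X_j.
Proof. by rewrite /shift comp_mpolyXU -tnth_nth tnth_mktuple. Qed.

Lemma shiftZ j P c y : shift j P (c *: y) = c *: shift j P y.
Proof. exact: comp_mpolyZ. Qed.

Lemma shiftE j P y : shift j P y = \sum_(m <- msupp y) y@_m *: shift j P 'X_[m].
Proof. by rewrite {1}[y]mpolyE rmorph_sum /=; apply: eq_bigr => m _; rewrite shiftZ. Qed.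

Lemma shift_comp j P Q y :
  (forall i, i != j -> P i + Q i = 0) -> shift j Q (shift j P y) = y.
Proof.
move=> PQ; rewrite [shift j P y]shiftE rmorph_sum [RHS]mpolyE /=.
apply: eq_bigr => m _; rewrite shiftZ shiftX rmorph_prod /=; congr (_ *: _).
rewrite [RHS]mpolyXE_id; apply: eq_bigr => i _; rewrite rmorphXn /=; congr (_ ^+ _).
have [->|ij] := eqVneq i j; first by rewrite shiftXU eqxx.
rewrite rmorphD /= shiftZ !shiftXU (negPf ij) eqxx.
by rewrite -addrA -scalerDl addrC [Q i + _]addrC PQ // scale0r add0r.
Qed.

Lemma shiftK j P : cancel (shift j P) (shift j (fun i => - P i)).
Proof. by move=> y; apply: shift_comp => i _; rewrite subrr. Qed.

Lemma shiftNK j P : cancel (shift j (fun i => - P i)) (shift j P).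
Proof. by move=> y; apply: shift_comp => i _; rewrite addNr. Qed.

Lemma dhomog_prodX (I : finType) (F : I -> {mpoly R[N]}) (d e : I -> nat) :
  (forall i, F i \is (d i).-homog) ->
  \prod_i F i ^+ e i \is (\sum_i d i * e i)%N.-homog.
Proof.
move=> hF; elim/big_rec2: _ => [|i y z _ hz]; first exact: dhomog1.
by apply: dhomogM => //; apply: dhomogMn.
Qed.

Lemma dhomog_prod_ord (k d : nat) (F : 'I_k -> {mpoly R[N]}) :
  (forall i, F i \is d.-homog) -> \prod_i F i \is (d * k)%N.-homog.
Proof.
move=> hF; have := dhomog_prodX (fun=> 1%N) hF.
under eq_bigr do rewrite expr1.
by under [X in X.-homog]eq_bigr do rewrite muln1;
  rewrite sum_nat_const card_ord mulnC.
Qed.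

Lemma shift_homog j P d y : y \is d.-homog -> shift j P y \is d.-homog.
Proof.
move=> hy; rewrite shiftE big_seq; apply: rpred_sum => m my; apply: rpredZ.
rewrite -(homog_mdeg hy my) mdegE shiftX.
have -> : (\sum_i m i = \sum_i 1 * m i)%N by apply: eq_bigr => i; rewrite mul1n.
apply: dhomog_prodX => i; case: ifP => _; first by rewrite dhomogX /= mdeg1.
by rewrite rpredD ?rpredZ // dhomogX /= mdeg1.
Qed.

Lemma shift_meval j P y : P j = 1 -> (shift j P y).@[axis_point j] = y.@[P].
Proof.
move=> Pj; rewrite comp_mpoly_meval; apply: meval_eq => i.
rewrite tnth_mktuple; have [->|ij] := eqVneq i j.
  by rewrite mevalXU /axis_point eqxx Pj.
by rewrite mevalD mevalZ !mevalXU /axis_point eqxx (negPf ij) add0r mulr1.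
Qed.

Lemma shift_vanishing_meval j P y :
  P j = 1 -> vanishing_order j 1 (shift j P y) -> y.@[P] = 0.
Proof. by move=> Pj /vanishing_order1_meval; rewrite shift_meval. Qed.

Lemma meval_shift_vanishing j P d y :
  P j = 1 -> y \is d.-homog -> y.@[P] = 0 ->
  vanishing_order j 1 (shift j P y).
Proof.
move=> Pj hy y0; apply: (@meval_vanishing_order1 j d); first exact: shift_homog.
by rewrite shift_meval.
Qed.

Lemma off_degree_split j m : (0 < off_degree j m)%N ->
  exists2 i, i != j & exists w, m = (U_(i) + w)%MM.
Proof.
rewrite lt0n sum_nat_eq0 => /forall_inPn [i ij mi]; exists i => //.
by exists (m - U_(i))%MM; rewrite addmC submK // lep1mP.
Qed.

(** Each monomial of the shifted polynomial has two factors other than the [j]-th variable. Shifted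
    back, they become linear forms vanishing at [P], and by the product rule one of them remains in
    every term of the derivative. *)
Lemma shift_vanishing2_mderiv j P y (a : 'I_N) : P j = 1 ->
  vanishing_order j 2 (shift j P y) -> (y^`M(a)).@[P] = 0.
Proof.
move=> Pj vy; rewrite -[y](shiftK j P) shiftE; move: (shift j P y) vy => z vz.
rewrite [mderiv _ _]raddf_sum [meval _ _]raddf_sum big_seq big1 //= => m /vz mz.
rewrite linearZ /= mevalZ.
suff -> : (shift j (fun i => - P i) 'X_[m])^`M(a).@[P] = 0 by rewrite mulr0.
have [i ij [w mE]] : exists2 i, i != j & exists w, m = (U_(i) + w)%MM.
  by apply: off_degree_split; apply: leq_trans mz.
have [i' ij' [w' wE]] : exists2 i, i != j & exists w', w = (U_(i) + w')%MM.
  apply: off_degree_split; move: mz; rewrite mE off_degreeD.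
  rewrite {1}/off_degree (bigD1 i) //= big1 ?addn0 => [|i1 /andP [_ h]].
    by rewrite mnm1E eqxx.
  by rewrite mnm1E eq_sym (negPf h).
have ev0 i1 : i1 != j -> ('X_i1 + (- P i1) *: 'X_j).@[P] = 0 :> R.
  by move=> h; rewrite mevalD mevalZ !mevalXU Pj mulr1 subrr.
rewrite mE wE !mpolyXD !rmorphM /= !shiftXU (negPf ij) (negPf ij').
move: (ev0 _ ij) (ev0 _ ij'); move: (_ + _) (_ + _) => u u' u0 u'0.
by rewrite !mderivM !(mevalD, mevalM) u0 u'0 !(mulr0, mul0r, addr0).
Qed.

End VanishingOrder.

(** * Coordinates over the subring of q-th powers *)

Lemma mcoeff_mulX (N : nat) (R : comNzRingType) (m w : 'X_{1..N})
    (y : {mpoly R[N]}) :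
  ('X_[m] * y)@_w = if (m <= w)%MM then y@_(w - m)%MM else 0.
Proof.
case: ifP => mw; first by rewrite -{1}(submK mw) addmC mulrC mcoeffMX.
apply: contraFeq mw; rewrite -mcoeff_msupp => /msuppM_le /allpairsP.
by move=> [[m1 m2] /= [/mem_msuppXP -> _ ->]]; apply: lem_addr.
Qed.

Section FrobeniusRoot.
Variables (N : nat) (F : closedFieldType) (l e : nat).
Hypothesis lF : l \in [pchar F].
Local Notation q := (l ^ e)%N.
Implicit Types (v w m : 'X_{1..N}) (y z h : {mpoly F[N]}).

Lemma pchar_prime_gt1 : (1 < l)%N.
Proof. by case/andP: lF => /prime_gt1. Qed.

Lemma frobenius_power_gt0 : (0 < q)%N.
Proof. by rewrite expn_gt0 ltnW // pchar_prime_gt1. Qed.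
Local Notation q_gt0 := frobenius_power_gt0.

Lemma expr0_frobenius (S : nzRingType) : (0 : S) ^+ q = 0.
Proof. by rewrite expr0n gtn_eqF ?q_gt0. Qed.

Lemma pchar_nat_power : [pchar F].-nat q.
Proof.
by rewrite pnatX pnatE ?lF //; case/andP: lF.
Qed.

Lemma pchar_mpoly_nat_power : [pchar {mpoly F[N]}].-nat q.
Proof.
have lM : l \in [pchar {mpoly F[N]}].
  case/andP: lF => lp l0; rewrite inE lp -mpolyC_nat /= mpolyC_eq0; exact: l0.
by rewrite pnatX pnatE ?lM //; case/andP: lF.
Qed.

Lemma frobeniusD (x y : F) : (x + y) ^+ q = x ^+ q + y ^+ q.
Proof. exact: exprDn_pchar pchar_nat_power. Qed.

Lemma frobenius_mpolyD y z : (y + z) ^+ q = y ^+ q + z ^+ q.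
Proof. exact: exprDn_pchar pchar_mpoly_nat_power. Qed.

Lemma frobenius_mpoly_sum (I : Type) (r : seq I) (P : pred I)
    (G : I -> {mpoly F[N]}) :
  (\sum_(i <- r | P i) G i) ^+ q = \sum_(i <- r | P i) G i ^+ q.
Proof.
elim/big_rec2: _ => [|i y z _ <-]; first by rewrite expr0_frobenius.
by rewrite frobenius_mpolyD.
Qed.

Lemma frobenius_inj : injective (fun x : F => x ^+ q).
Proof.
move=> x y /= xy; apply/eqP; rewrite -subr_eq0.
have : (x - y) ^+ q == 0.
  have := frobeniusD (x - y) y; rewrite subrK xy.
  by move/(congr1 (fun t => t - y ^+ q)); rewrite addrK subrr => <-.
by rewrite expf_eq0 => /andP [].
Qed.

Lemma frobenius_surj (x : F) : exists y : F, y ^+ q == x.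
Proof.
have /closed_rootP [y] : size ('X^q - x%:P : {poly F}) != 1%N.
  by rewrite size_XnsubC ?q_gt0 // eqSS -lt0n q_gt0.
by rewrite rootE !hornerE subr_eq0; exists y.
Qed.

Definition frobenius_root (x : F) : F := xchoose (frobenius_surj x).

Lemma frobenius_rootK x : frobenius_root x ^+ q = x.
Proof. exact/eqP/(xchooseP (frobenius_surj x)). Qed.

Lemma frobenius_rootE (x y : F) : y ^+ q = x -> frobenius_root x = y.
Proof. by move=> yx; apply: frobenius_inj; rewrite /= frobenius_rootK. Qed.

Lemma frobenius_root0 : frobenius_root 0 = 0.
Proof. by apply: frobenius_rootE; rewrite expr0_frobenius. Qed.

Lemma frobenius_root_eq0 x : (frobenius_root x == 0) = (x == 0).
Proof. by rewrite -[in RHS](frobenius_rootK x) expf_eq0 q_gt0. Qed.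

Lemma frobenius_rootD (x y : F) :
  frobenius_root (x + y) = frobenius_root x + frobenius_root y.
Proof. by apply: frobenius_rootE; rewrite frobeniusD !frobenius_rootK. Qed.

Lemma frobenius_rootM (x y : F) :
  frobenius_root (x * y) = frobenius_root x * frobenius_root y.
Proof. by apply: frobenius_rootE; rewrite exprMn !frobenius_rootK. Qed.

(* Over a perfect field the monomials 'X_[v] with all exponents below q form a
   basis of the polynomial ring over its subring of q-th powers;
   [frobenius_coord v y] is the q-th root of the coordinate of y along v. *)
Definition frobenius_coord v y : {mpoly F[N]} :=
  \sum_(w : 'X_{1..N < msize y}) frobenius_root y@_(w *+ q + v)%MM *: 'X_[w].

Lemma mcoeff_frobenius_coord v y w :
  (frobenius_coord v y)@_w = frobenius_root y@_(w *+ q + v)%MM.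
Proof.
rewrite /frobenius_coord; case: (ltnP (mdeg w) (msize y)) => [wy|yw].
  exact: (mcoeff_mpoly (fun m => frobenius_root y@_(m *+ q + v)%MM)).
rewrite [y@__]memN_msupp_eq0 ?frobenius_root0; last first.
  apply: msize_mdeg_ge; rewrite mdegD mdegMn; apply: leq_trans yw _.
  by apply: leq_trans (leq_addr _ _); rewrite leq_pmulr ?q_gt0.
rewrite raddf_sum big1 //= => u _; rewrite mcoeffZ mcoeffX.
case: eqP => [uw|_]; last by rewrite mulr0.
by have := bmdeg u; rewrite uw ltnNge yw.
Qed.

Lemma frobenius_coordD v y z :
  frobenius_coord v (y + z) = frobenius_coord v y + frobenius_coord v z.
Proof.
apply/mpolyP => w; rewrite mcoeffD !mcoeff_frobenius_coord mcoeffD.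
exact: frobenius_rootD.
Qed.

Lemma frobenius_coord0 v : frobenius_coord v 0 = 0.
Proof. by apply/mpolyP => w; rewrite mcoeff_frobenius_coord !mcoeff0 frobenius_root0. Qed.

Lemma frobenius_coord_sum v (I : Type) (r : seq I) (P : pred I)
    (G : I -> {mpoly F[N]}) :
  frobenius_coord v (\sum_(i <- r | P i) G i) =
  \sum_(i <- r | P i) frobenius_coord v (G i).
Proof.
elim/big_rec2: _ => [|i y z _ <-]; first exact: frobenius_coord0.
by rewrite frobenius_coordD.
Qed.

(** Coordinates are linear over the subring of [q]-th powers, up to extracting the root. *)
Lemma frobenius_coord_mul v h y : (forall i, v i < q)%N ->
  frobenius_coord v (h ^+ q * y) = h * frobenius_coord v y.
Proof.
move=> vq; elim/mpolyind: h => [|c m h _ _ IH].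
  by rewrite expr0_frobenius !mul0r frobenius_coord0.
rewrite frobenius_mpolyD !mulrDl frobenius_coordD IH; congr (_ + _).
apply/mpolyP => w; rewrite mcoeff_frobenius_coord exprZn mpolyXn.
rewrite -!scalerAl !mcoeffZ frobenius_rootM (@frobenius_rootE _ c) //.
congr (_ * _); rewrite !mcoeff_mulX.
(* All exponents of [v] are below [q], so adding [v] never reaches the next multiple of [q]. *)
have -> : (m *+ q <= w *+ q + v)%MM = (m <= w)%MM.
  apply/mnm_lepP/mnm_lepP => H i; have := H i; rewrite mnmDE !mulmnE.
    move=> {}H; rewrite leqNgt; apply/negP => wm.
    have := leq_mul wm (leqnn q); rewrite mulSn leqNgt => /negP; apply.
    by apply: leq_ltn_trans H _; rewrite addnC ltn_add2r vq.
  by move=> mw; apply: leq_trans (leq_addr _ _); rewrite leq_mul2r mw orbT.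
case: ifP => mw; last by rewrite frobenius_root0.
rewrite mcoeff_frobenius_coord; congr (frobenius_root _@__).
apply/mnmP => i; rewrite !(mnmBE, mnmDE, mulmnE) mulnBl addnBAC //.
by rewrite leq_mul2r (mnm_lepP mw) orbT.
Qed.

Definition small_mnm (f : {ffun 'I_N -> 'I_q}) : 'X_{1..N} :=
  [multinom (f i : nat) | i < N].

Lemma small_mnm_lt f i : (small_mnm f i < q)%N.
Proof. by rewrite mnmE. Qed.

Lemma frobenius_coordE y :
  y = \sum_f 'X_[small_mnm f] * frobenius_coord (small_mnm f) y ^+ q.
Proof.
elim/mpolyind: y => [|c m y _ _ {1}->].
  rewrite big1 // => f _; rewrite frobenius_coord0 expr0_frobenius.
  by rewrite mulr0.
under [RHS]eq_bigr do rewrite frobenius_coordD frobenius_mpolyD mulrDr.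
rewrite big_split; congr (_ + _) => /=.
(* Euclidean division of the exponents by [q]: a monomial has a single nonzero coordinate, along its
   vector of remainders. *)
pose f0 := [ffun i => Ordinal (ltn_pmod (m i) q_gt0)] : {ffun 'I_N -> 'I_q}.
pose w0 : 'X_{1..N} := [multinom (m i %/ q)%N | i < N].
have mE : m = (w0 *+ q + small_mnm f0)%MM.
  by apply/mnmP => i; rewrite mnmDE mulmnE !mnmE ffunE -divn_eq.
have key f w : (m == w *+ q + small_mnm f)%MM = (f == f0) && (w == w0).
  apply/eqP/andP => [mE'|[/eqP -> /eqP ->]]; last by [].
  have E i : m i = (w i * q + f i)%N by rewrite {1}mE' mnmDE mulmnE mnmE.
  split; apply/eqP.
    by apply/ffunP => i; apply: val_inj; rewrite ffunE /= E modnMDl modn_small.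
  apply/mnmP => i; rewrite mnmE E divnMDl ?q_gt0 //.
  by rewrite divn_small // addn0.
have coordE f : frobenius_coord (small_mnm f) (c *: 'X_[m]) =
    if f == f0 then frobenius_root c *: 'X_[w0] else 0.
  apply/mpolyP => w; rewrite mcoeff_frobenius_coord mcoeffZ mcoeffX key.
  case: ifP => _ /=; last by rewrite mulr0 frobenius_root0 mcoeff0.
  rewrite mcoeffZ mcoeffX [w == _]eq_sym.
  by case: (w0 == w); rewrite ?mulr1 ?mulr0 ?frobenius_root0.
rewrite (bigD1 f0) //= coordE eqxx big1 ?addr0 => [|f /negPf f_f0].
  by rewrite exprZn frobenius_rootK mpolyXn -scalerAr -mpolyXD addmC -mE.
by rewrite coordE f_f0 expr0_frobenius mulr0.
Qed.

Lemma frobenius_coord_homog v d y : y \is d.-homog ->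
  frobenius_coord v y \is ((d - mdeg v) %/ q)%N.-homog.
Proof.
move=> hy; apply/dhomogP => w; rewrite mcoeff_msupp mcoeff_frobenius_coord.
rewrite frobenius_root_eq0 -mcoeff_msupp => /(homog_mdeg hy) <-.
by rewrite mdegD mdegMn addnK mulnK ?q_gt0.
Qed.

(** A monomial [w] of the coordinate comes from the monomial [w *+ q + v] of [y], so [d - mdeg v] is
    exactly divisible by [q] and nothing is truncated. *)
Lemma frobenius_coord_eq0 v d y :
  y \is d.-homog -> frobenius_coord v y != 0 ->
  d = ((d - mdeg v) %/ q * q + mdeg v)%N.
Proof.
move=> hy; rewrite -mleadc_eq0 mcoeff_frobenius_coord frobenius_root_eq0.
rewrite -mcoeff_msupp => /(homog_mdeg hy) <-.
by rewrite mdegD mdegMn addnK mulnK ?q_gt0.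
Qed.

Lemma frobenius_coord_large v d y : y \is d.-homog -> (d < mdeg v)%N ->
  frobenius_coord v y = 0.
Proof.
move=> hy dv; apply/eqP; apply: contraTT dv => /(frobenius_coord_eq0 hy) ->.
by rewrite -leqNgt leq_addl.
Qed.

(** A contribution below [q] from [v] cannot make up for a missing multiple of [q] in the
    off-degree. *)
Lemma vanishing_order_frobenius_coord j k v y :
  vanishing_order j (q * k) y -> (off_degree j v < q)%N ->
  vanishing_order j k (frobenius_coord v y).
Proof.
move=> vy vq w; rewrite mcoeff_msupp mcoeff_frobenius_coord frobenius_root_eq0.
rewrite -mcoeff_msupp => /vy; rewrite off_degreeD off_degreeMn => H.
rewrite -ltnS -(ltn_pmul2l q_gt0); apply: leq_ltn_trans H _.
by rewrite mulnS [(q * _)%N]mulnC addnC ltn_add2r.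
Qed.

(* The coordinates of y in the coordinates centred at P control those of y in
   the original ones: change of variables is compatible with q-th powers. *)
Lemma shift_frobenius_coord_vanishing (j : 'I_N) (P : 'I_N -> F) k y v :
  (forall i, v i < q)%N ->
  (forall f, vanishing_order j k
    (frobenius_coord (small_mnm f) (shift j P y))) ->
  vanishing_order j k (shift j P (frobenius_coord v y)).
Proof.
move=> vq H; pose sh' := shift j (fun i => - P i).
have yE : y = \sum_f sh' (frobenius_coord (small_mnm f) (shift j P y)) ^+ q *
                     sh' 'X_[small_mnm f].
  rewrite -{1}[y](shiftK j P) [X in shift _ _ X = _]frobenius_coordE.
  rewrite rmorph_sum /=; apply: eq_bigr => f _.
  by rewrite rmorphM rmorphXn mulrC.
rewrite [X in frobenius_coord _ X]yE frobenius_coord_sum [shift j P _]rmorph_sum.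
apply: vanishing_order_sum => f _ /=; rewrite frobenius_coord_mul //.
by rewrite rmorphM /= shiftNK mulrC; apply: vanishing_orderMl.
Qed.

End FrobeniusRoot.

(** * The containment in positive characteristic *)

Lemma meval_prod (N : nat) (R : comNzRingType) (v : 'I_N -> R) (I : Type)
    (r : seq I) (P : pred I) (f : I -> {mpoly R[N]}) :
  (\prod_(i <- r | P i) f i).@[v] = \prod_(i <- r | P i) (f i).@[v].
Proof. exact: (rmorph_prod (meval v)). Qed.

Lemma meval_sum (N : nat) (R : comNzRingType) (v : 'I_N -> R) (I : Type)
    (r : seq I) (P : pred I) (f : I -> {mpoly R[N]}) :
  (\sum_(i <- r | P i) f i).@[v] = \sum_(i <- r | P i) (f i).@[v].
Proof. exact: (raddf_sum (meval v)). Qed.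

Lemma meval_exp (N : nat) (R : comNzRingType) (v : 'I_N -> R) (k : nat)
    (f : {mpoly R[N]}) : (f ^+ k).@[v] = f.@[v] ^+ k.
Proof. exact: (rmorphXn (meval v)). Qed.

Lemma mderiv_homog (N : nat) (R : comNzRingType) (a : 'I_N) (d : nat)
    (y : {mpoly R[N]}) :
  y \is d.-homog -> y^`M(a) \is d.-1.-homog.
Proof.
move=> hy; apply/dhomogP => m; rewrite mcoeff_msupp mcoeff_mderiv => ym.
have : (m + U_(a))%MM \in msupp y.
  by rewrite mcoeff_msupp; apply: contraNneq ym => ->; rewrite mul0rn.
by move/(homog_mdeg hy); rewrite mdegD mdeg1 addn1 => <-.
Qed.

Lemma mderiv_eq0 (N : nat) (R : idomainType) (l : nat) (y : {mpoly R[N]})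
    (m : 'X_{1..N}) :
  l \in [pchar R] -> (forall a, y^`M(a) = 0) -> m \in msupp y ->
  forall a, (l %| m a)%N.
Proof.
move=> lR dy my a; have [->|ma] := eqVneq (m a) 0%N; first exact: dvdn0.
have /(congr1 (mcoeff (m - U_(a)))) := dy a.
rewrite mcoeff_mderiv mcoeff0 submK ?lep1mP // mnmBE mnm1E eqxx subn1.
rewrite prednK ?lt0n // (dvdn_pcharf lR) => h.
have /eqP : y@_m * (m a)%:R = 0 by rewrite mulr_natr.
by move: my; rewrite mcoeff_msupp mulf_eq0 => /negPf ->.
Qed.

Section PositiveCharacteristic.
Variables (F : closedFieldType) (l n s alpha : nat).
Hypothesis lF : l \in [pchar F].
Hypothesis n_gt0 : (0 < n)%N.
Variables (j : 'I_n -> 'I_3) (P : 'I_n -> 'I_3 -> F).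
Hypothesis Pj : forall i, P i (j i) = 1.
Variable g : 'I_s -> {mpoly F[3]}.
Hypothesis g_homog : forall b, g b \is alpha.-homog.
Hypothesis g_vanish : forall b i, (g b).@[P i] = 0.
Hypothesis g_gen : forall d y, y \is d.-homog -> (forall i, y.@[P i] = 0) ->
  exists h : 'I_s -> {mpoly F[3]}, y = \sum_b h b * g b.

Lemma vanishing_form_degree d y : y != 0 -> y \is d.-homog ->
  (forall i, y.@[P i] = 0) -> (alpha <= d)%N.
Proof.
move=> yn0 hy y0; have [h yE] := g_gen hy y0.
rewrite -(homog_mdeg hy (mlead_supp yn0)); move: (mlead_supp yn0).
rewrite {2}yE => /msupp_sum_le /flattenP [_ /mapP [b _ ->]].
move=> /msuppM_le /allpairsP [[m1 m2] /= [_ /(homog_mdeg (g_homog b)) <- ->]].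
by rewrite mdegD leq_addl.
Qed.

(** The product of one nonzero linear form through each point is a nonzero form vanishing at all of
    them, and it is a combination of the generators. *)
Lemma exists_generator_neq0 : exists b, g b != 0.
Proof.
have /choice [a aj] : forall i, exists a : 'I_3, a != j i.
  by move=> i; exists (j i + 1); rewrite -subr_eq0 addrAC subrr add0r.
pose L i : {mpoly F[3]} := 'X_(a i) - P i (a i) *: 'X_(j i).
have Ln0 i : L i != 0.
  apply/eqP => /(congr1 (mcoeff U_(a i))).
  rewrite mcoeffB mcoeffZ !mcoeffX eqxx mcoeff0 eq_mnm1 eq_sym (negPf (aj i)).
  by rewrite mulr0 subr0 => /eqP; rewrite oner_eq0.
have hL i : L i \is 1.-homog.
  by rewrite rpredB ?rpredZ // dhomogX /= mdeg1.
have [|h hE] := g_gen (dhomog_prod_ord hL).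
  move=> i; rewrite meval_prod (bigD1 i) //= mevalB mevalZ !mevalXU Pj mulr1.
  by rewrite subrr mul0r.
apply: contrapT => no; have : \prod_i L i != 0 by apply/prodf_neq0.
rewrite hE big1 ?eqxx // => b _; have [->|gb] := eqVneq (g b) 0.
  by rewrite mulr0.
by case: no; exists b.
Qed.

(* With three variables, [off_degree v <= 2 (q - 1)], which is where the factor
   2 in the symbolic power comes from. *)
Lemma frobenius_coord_vanish e y (v : 'X_{1..3}) i :
  (forall a, v a < l ^ e)%N ->
  vanishing_order (j i) (2 * l ^ e) (shift (j i) (P i) y) ->
  (frobenius_coord e lF v y).@[P i] = 0.
Proof.
move=> vq vy; apply: (@shift_vanishing_meval _ _ (j i)) => //.
apply: shift_frobenius_coord_vanishing => // f w.
rewrite mcoeff_msupp mcoeff_frobenius_coord frobenius_root_eq0 -mcoeff_msupp.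
move=> /vy; rewrite off_degreeD off_degreeMn lt0n; apply: contraTneq => ->.
rewrite mul0n add0n -ltnNge.
have fq := small_mnm_lt f.
rewrite /off_degree; set m := small_mnm f in fq *.
have -> : (\sum_(a < 3 | a != j i) m a =
           \sum_(a < 2) m (lift (j i) a))%N.
  apply: (@addnI (m (j i))).
  have <- : (\sum_(a < 3) m a = m (j i) + \sum_(a < 3 | a != j i) m a)%N.
    by rewrite (bigD1 (j i)).
  by rewrite (bigD1_ord (j i)).
rewrite !big_ord_recl big_ord0 addn0.
by rewrite -addSn mul2n -addnn leq_add // ltnW.
Qed.

(** Every Frobenius coordinate of [y] is a form vanishing at all points, hence a combination of the
    [g b]; taking [q]-th powers and reassembling puts [y] in the Frobenius power. *)
Lemma symbolic_frobenius_expand e d y :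
  y \is d.-homog ->
  (forall i, vanishing_order (j i) (2 * l ^ e) (shift (j i) (P i) y)) ->
  exists H : 'I_s -> {mpoly F[3]}, y = \sum_b H b * g b ^+ (l ^ e).
Proof.
move=> hy vy.
have /choice [h hE] : forall f : {ffun 'I_3 -> 'I_(l ^ e)},
    exists h : 'I_s -> {mpoly F[3]},
      frobenius_coord e lF (small_mnm f) y = \sum_b h b * g b.
  move=> f; apply: g_gen; first exact: frobenius_coord_homog hy.
  by move=> i; apply: frobenius_coord_vanish => // a; apply: small_mnm_lt.
exists (fun b => \sum_f 'X_[small_mnm f] * h f b ^+ (l ^ e)).
rewrite [LHS](frobenius_coordE e lF).
under [RHS]eq_bigr do rewrite mulr_suml.
rewrite exchange_big; apply: eq_bigr => f _.
rewrite hE (frobenius_mpoly_sum e lF) mulr_sumr; apply: eq_bigr => b _.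
by rewrite exprMn mulrA.
Qed.

(** * A form in the symbolic power of exponent [2 * k] *)

Variables (f : {mpoly F[3]}) (d k : nat).
Hypothesis k_gt0 : (0 < k)%N.
Hypothesis f_homog : f \is d.-homog.
Hypothesis f_vanish :
  forall i, vanishing_order (j i) (2 * k) (shift (j i) (P i) f).

Lemma power_vanish q b i :
  vanishing_order (j i) (2 * q)
    (shift (j i) (P i) (f ^+ (q %/ k) * g b ^+ (2 * (q %% k)))).
Proof.
rewrite rmorphM !rmorphXn /= {1}(divn_eq q k) mulnDr mulnCA.
apply: vanishing_orderM; last first.
  rewrite -{1}[(2 * _)%N]muln1; apply: (@vanishing_orderXn _ _ (j i) 1).
  exact: meval_shift_vanishing (g_homog b) _.
by apply: (@vanishing_orderXn _ _ (j i) (2 * k)); apply: f_vanish.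
Qed.

Lemma power_homog q b :
  f ^+ (q %/ k) * g b ^+ (2 * (q %% k)) \is
    (d * (q %/ k) + alpha * (2 * (q %% k)))%N.-homog.
Proof. by apply: dhomogM; apply: dhomogMn. Qed.

Lemma symbolic_in_power :
  exists h : {ffun 'I_k -> 'I_s} -> {mpoly F[3]},
    f = \sum_t h t * \prod_(i < k) g (t i).
Proof.
have [b gb] := exists_generator_neq0.
(* The multiplier [c] must not depend on [q]: its exponent bounds [2 * (q %% k) * k] for all [q].
   Only then is [q] chosen larger than the degree of [c]. *)
pose c := g b ^+ (2 * k * k); pose e := msize c; pose q := (l ^ e)%N.
have cq : (msize c < q)%N by apply/ltn_expl/(pchar_prime_gt1 lF).
have [H HE] := symbolic_frobenius_expand (power_homog q b)
  (@power_vanish q b).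
have [C CE] : exists C, c * f ^+ q =
    C * (f ^+ (q %/ k) * g b ^+ (2 * (q %% k))) ^+ k.
  exists (g b ^+ (2 * (k - q %% k) * k) * f ^+ (q %% k)).
  rewrite {1}(divn_eq q k) exprD exprMn -!exprM /c.
  have -> : (2 * k * k = 2 * (k - q %% k) * k + 2 * (q %% k) * k)%N.
    by rewrite -mulnDl -mulnDr subnK // ltnW // ltn_pmod.
  have mulrAC4 (x y z w : {mpoly F[3]}) : x * y * (z * w) = x * w * (z * y).
    by rewrite mulrACA [RHS]mulrACA; congr (_ * _); rewrite mulrC.
  by rewrite exprD mulrAC4.
have [h' h'E] : exists h' : {ffun 'I_k -> 'I_s} -> {mpoly F[3]},
    c * f ^+ q = \sum_(t : {ffun 'I_k -> 'I_s})
                   (\prod_(i < k) g (t i)) ^+ q * h' t.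
  (* The [k]-th power of the Frobenius expansion is multiplied out over all choices [t] of [k]
     generators. *)
  exists (fun t => C * \prod_(i < k) H (t i)).
  rewrite CE HE -[in LHS](card_ord k) -prodr_const bigA_distr_bigA mulr_sumr.
  apply: eq_bigr => t _; by rewrite big_split /= prodrXl [LHS]mulrA [LHS]mulrC.
have c0 : c != 0 by rewrite expf_neq0.
(* Since [c] has degree below [q], its coordinate along its leading exponent is a nonzero constant.
   Taking this coordinate of [c * f ^+ q] therefore returns [f] up to that constant. *)
pose v := mlead c; have vE : mdeg v = (msize c).-1 by rewrite -mlead_deg.
have vq a : (v a < q)%N.
  apply: leq_ltn_trans (_ : mdeg v < q)%N; first by rewrite mdegE (bigD1 a) ?leq_addr.
  by rewrite vE (leq_ltn_trans (leq_pred _)).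
have cE : frobenius_coord e lF v c = (frobenius_root e lF (mleadc c))%:MP.
  apply/mpolyP => w; rewrite mcoeff_frobenius_coord mcoeffC.
  have [->|w0] := eqVneq w 0%MM.
    by rewrite mulr1; congr (frobenius_root _ _ _@__); apply/mnmP => a;
      rewrite mnmDE mulmnE mnmE mul0n.
  rewrite mulr0 [c@__]memN_msupp_eq0 ?frobenius_root0 //.
  apply: msize_mdeg_ge; rewrite mdegD mdegMn; apply: leq_trans (leq_addr _ _).
  apply: leq_trans (ltnW cq) _; rewrite leq_pmull // lt0n.
  by rewrite mdeg_eq0.
have r0 : frobenius_root e lF (mleadc c) != 0.
  by rewrite frobenius_root_eq0 mleadc_eq0.
exists (fun t => (frobenius_root e lF (mleadc c))^-1 *:
                 frobenius_coord e lF v (h' t)).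
transitivity ((frobenius_root e lF (mleadc c))^-1 *:
              frobenius_coord e lF v (f ^+ q * c)).
  by rewrite frobenius_coord_mul // cE mulrC mul_mpolyC scalerA mulVf ?scale1r.
rewrite mulrC h'E frobenius_coord_sum scaler_sumr; apply: eq_bigr => t _.
by rewrite frobenius_coord_mul // mulrC scalerAl.
Qed.

Lemma no_doubly_vanishing_form z : z != 0 -> z \is alpha.-homog ->
  (forall i, vanishing_order (j i) 2 (shift (j i) (P i) z)) -> False.
Proof.
move=> zn0 hz vz; pose i0 := Ordinal n_gt0.
have z0 i : z.@[P i] = 0.
  by apply: (@shift_vanishing_meval _ _ (j i)) => // m /vz; apply: ltnW.
(* A constant that vanishes at a point is zero; the existence of a point enters here. *)
have alpha0 : (0 < alpha)%N.
  rewrite lt0n; apply/eqP => a0; move/eqP: (zn0); apply; have := z0 i0.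
  have -> : z = (z@_0%MM)%:MP.
    apply: msize1_polyC; rewrite -mlead_deg //.
    by rewrite (homog_mdeg hz (mlead_supp zn0)) a0.
  by rewrite mevalC => ->; rewrite mpolyC0.
have dz a : z^`M(a) = 0.
  apply/eqP; apply: contrapT => /negP dn0.
  have : (alpha <= alpha.-1)%N.
    apply: vanishing_form_degree dn0 (mderiv_homog a hz) _ => i.
    exact: (@shift_vanishing2_mderiv _ _ (j i)).
  by rewrite -ltnS prednK // ltnn.
have lz m : m \in msupp z -> forall a, (l %| m a)%N := mderiv_eq0 lF dz.
pose w := frobenius_coord 1 lF 0%MM z.
(* All exponents of [z] are divisible by [l], so with [q = l] only the coordinate along the zero
   exponent is nonzero. *)
have zE : z = w ^+ l.
  rewrite [LHS](frobenius_coordE 1 lF).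
  have l0 : (0 < l ^ 1)%N by rewrite expn1 (ltnW (pchar_prime_gt1 lF)).
  pose f0 : {ffun 'I_3 -> 'I_(l ^ 1)} := [ffun=> Ordinal l0].
  have f0E : small_mnm f0 = 0%MM.
    by apply/mnmP => a; rewrite mnmE mnmE ffunE.
  rewrite (bigD1 f0) //= f0E mpolyX0 mul1r big1 ?addr0 ?expn1 // => f1 f1f0.
  suff -> : frobenius_coord 1 lF (small_mnm f1) z = 0.
    by rewrite (expr0_frobenius 1 lF) mulr0.
  apply/mpolyP => u; rewrite mcoeff_frobenius_coord mcoeff0.
  apply/eqP; rewrite frobenius_root_eq0; apply: contraNT f1f0.
  rewrite -mcoeff_msupp => /lz uz; apply/eqP/ffunP => a; apply: val_inj.
  rewrite ffunE /=; have := uz a; have := ltn_ord (f1 a).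
  rewrite mnmDE mulmnE mnmE; move: (nat_of_ord (f1 a)) => r; rewrite expn1 => rl.
  by rewrite dvdn_addr ?dvdn_mull // /dvdn modn_small // => /eqP.
have wn0 : w != 0.
  by apply: contraNneq zn0 => w0; rewrite zE w0 expr0n gtn_eqF // (ltnW (pchar_prime_gt1 lF)).
have hw := frobenius_coord_homog 1 lF 0%MM hz.
have : (alpha <= (alpha - mdeg (0%MM : 'X_{1..3})) %/ l ^ 1)%N.
  apply: vanishing_form_degree wn0 hw _ => i; apply/eqP.
  by have := z0 i; rewrite zE meval_exp => /eqP; rewrite expf_eq0 => /andP [].
rewrite mdeg0 subn0 expn1 leqNgt ltn_Pdiv //; exact: pchar_prime_gt1 lF.
Qed.

Lemma symbolic_degree : f != 0 -> (k * alpha.+1 <= d)%N.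
Proof.
move=> fn0; rewrite leqNgt; apply/negP => dk.
have [b gb] := exists_generator_neq0.
(* This makes [q %/ k] larger than [2 * k * alpha], which bounds the degree contributed by the power
   of [g b]. With [d < k * alpha.+1], the degree [D] of [y] then stays below [q * alpha.+1]. *)
pose e := (k * (2 * k * alpha).+1)%N; pose q := (l ^ e)%N.
have eq : (e < q)%N by apply/ltn_expl/(pchar_prime_gt1 lF).
set y := f ^+ (q %/ k) * g b ^+ (2 * (q %% k)).
have yn0 : y != 0 by rewrite mulf_neq0 // expf_neq0.
have hy := power_homog q b; rewrite -/y in hy; set D := addn _ _ in hy.
have Dq : (D < q * alpha.+1)%N.
  have ak : ((2 * k * alpha).+1 <= q %/ k)%N by rewrite leq_divRL // mulnC ltnW.
  rewrite /D {3}(divn_eq q k); move: dk ak (ltn_pmod q k_gt0).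
  move: (q %/ k)%N (q %% k)%N => a r dk ak rk.
  have h1 : (d.+1 * a <= k * alpha.+1 * a)%N by rewrite leq_mul2r dk orbT.
  have h2 : (alpha * (2 * r) <= 2 * k * alpha)%N.
    by rewrite mulnC leq_mul2r leq_mul2l ltnW ?orbT.
  rewrite mulnDl [(a * k)%N]mulnC mulnAC.
  apply: leq_trans (leq_addr _ _); apply: leq_trans h1.
  rewrite mulSn addnC ltn_add2r; exact: leq_ltn_trans h2 ak.
(* A nonzero coordinate vanishes at all points, so it has degree at least [alpha]; the bound on [D]
   leaves room for exactly [alpha], with a remainder [mdeg v] below [q]. *)
have coord_small (v : 'X_{1..3}) : (forall a, v a < q)%N -> frobenius_coord e lF v y != 0 ->
    (mdeg v < q)%N /\ frobenius_coord e lF v y \is alpha.-homog.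
  move=> vq cn0; have hc := frobenius_coord_homog e lF v hy.
  have ac : (alpha <= (D - mdeg v) %/ l ^ e)%N.
    apply: vanishing_form_degree cn0 hc _ => i.
    by apply: frobenius_coord_vanish => //; apply: power_vanish.
  have DE := frobenius_coord_eq0 hy cn0; rewrite -/q in ac DE hc.
  have q0 : (0 < q)%N by apply: leq_ltn_trans eq.
  suff aE : ((D - mdeg v) %/ q)%N = alpha.
    split; last by rewrite -{1}aE.
    by move: Dq; rewrite DE aE mulnS mulnC addnC ltn_add2r.
  apply/eqP; rewrite eqn_leq ac andbT -ltnS -(ltn_pmul2l q0) mulnC.
  by apply: leq_ltn_trans Dq; rewrite [X in (_ <= X)%N]DE leq_addr.
have yE := frobenius_coordE e lF y.
have [f0 f0n] : exists f0 : {ffun 'I_3 -> 'I_q},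
    frobenius_coord e lF (small_mnm f0) y != 0.
  apply: contrapT => no; move/eqP: yn0; apply; rewrite yE big1 // => f1 _.
  have [->|h] := eqVneq (frobenius_coord e lF (small_mnm f1) y) 0.
    by rewrite (expr0_frobenius e lF) mulr0.
  by case: no; exists f1.
have [_ hc] := coord_small _ (small_mnm_lt f0) f0n.
apply: (no_doubly_vanishing_form f0n hc) => i.
apply: shift_frobenius_coord_vanishing => [a|f1]; first exact: small_mnm_lt.
(* The bound [mdeg v < q] persists in the centred coordinates because the shift preserves degrees.
   It gives off-degree below [q], so order [2 * q] for [y] yields order 2 for its coordinates. *)
have [large|small] := leqP q (mdeg (small_mnm f1)).
  suff -> : frobenius_coord e lF (small_mnm f1) (shift (j i) (P i) y) = 0.
    exact: vanishing_order0.
  rewrite yE rmorph_sum /= frobenius_coord_sum big1 // => f2 _.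
  rewrite rmorphM rmorphXn mulrC /= frobenius_coord_mul; last exact: small_mnm_lt.
  have [->|h] := eqVneq (frobenius_coord e lF (small_mnm f2) y) 0.
    by rewrite rmorph0 mul0r.
  have [f2q _] := coord_small _ (small_mnm_lt f2) h.
  have hX : shift (j i) (P i) 'X_[small_mnm f2] \is (mdeg (small_mnm f2)).-homog.
    by apply: shift_homog; rewrite dhomogX.
  by rewrite (frobenius_coord_large _ _ hX) ?mulr0 //; apply: leq_trans large.
apply: vanishing_order_frobenius_coord; first by rewrite mulnC; apply: power_vanish.
by apply: leq_ltn_trans small; rewrite (mdeg_off_degree (j i)) leq_addl.
Qed.

End PositiveCharacteristic.

(** * Interpolation certificates *)

Section InSpan.
Variables (N s : nat) (R : comNzRingType) (g : 'I_s -> {mpoly R[N]}).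
Implicit Types y z : {mpoly R[N]}.

(** Membership in the ideal is given by explicit coefficients, because these can be carried along a
    ring homomorphism. *)
Definition in_span y : Prop := exists h : 'I_s -> {mpoly R[N]}, y = \sum_b h b * g b.

Lemma in_span0 : in_span 0.
Proof. by exists (fun=> 0); rewrite big1 // => b _; rewrite mul0r. Qed.

Lemma in_spanD y z : in_span y -> in_span z -> in_span (y + z).
Proof.
move=> [h ->] [h' ->]; exists (fun b => h b + h' b).
by rewrite -big_split; apply: eq_bigr => b _; rewrite mulrDl.
Qed.

Lemma in_spanM y z : in_span z -> in_span (y * z).
Proof.
move=> [h ->]; exists (fun b => y * h b).
by rewrite mulr_sumr; apply: eq_bigr => b _; rewrite mulrA.
Qed.

Lemma in_spanZ c z : in_span z -> in_span (c *: z).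
Proof. by rewrite -mul_mpolyC; apply: in_spanM. Qed.

Lemma in_span_sum (I : Type) (r : seq I) (P : pred I) (G : I -> {mpoly R[N]}) :
  (forall i, P i -> in_span (G i)) -> in_span (\sum_(i <- r | P i) G i).
Proof.
move=> H; elim/big_rec: _ => [|i y Pi]; first exact: in_span0.
by apply: in_spanD; apply: H.
Qed.

Lemma in_span_gen b : in_span (g b).
Proof.
exists (fun b' => (b' == b)%:R); rewrite (bigD1 b) //= eqxx mul1r big1 ?addr0 //.
by move=> b' /negPf ->; rewrite mul0r.
Qed.

End InSpan.

Section Interpolation.
Variables (N n s : nat) (R : comNzRingType).
Variables (j : 'I_n -> 'I_N) (P : 'I_n -> 'I_N -> R).
Variable g : 'I_s -> {mpoly R[N]}.

(* [interpolates] in all degrees implies that every form vanishing at all P i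
   lies in (g). Unlike this consequence, it is a system of polynomial identities,
   hence passes to ring homomorphic images; [localizes] reduces it to the degrees
   e < n. *)
Definition interpolates (e : nat) (v : 'I_n -> {mpoly R[N]}) : Prop :=
  forall w : 'X_{1..N}, mdeg w = e ->
    in_span g ('X_[w] - \sum_i ('X_[w]).@[P i] *: v i).

(** Modulo the [g b], multiplying [v i] by any variable amounts to multiplying it by the [j i]-th
    variable and the corresponding coordinate of [P i], as if [v i] were supported at that point
    alone. *)
Definition localizes (v : 'I_n -> {mpoly R[N]}) : Prop :=
  forall i a, in_span g ('X_a * v i - P i a *: ('X_(j i) * v i)).

(** Split a variable off the monomial, multiply the identity for the remaining monomial by it, and
    correct each [v i] by localization. *)
Lemma interpolatesS e v : interpolates e v -> localizes v ->
  interpolates e.+1 (fun i => 'X_(j i) * v i) /\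
  localizes (fun i => 'X_(j i) * v i).
Proof.
move=> vI vL; split; last first.
  move=> i a; rewrite mulrCA scalerAr -mulrBr; exact/in_spanM/vL.
move=> w /esym we; have [a [w' wE]] : exists a, exists w', w = (U_(a) + w')%MM.
  have /existsP [a wa] : [exists a, w a != 0%N].
    rewrite -negb_forall; apply/negP => /forallP w0; move: we.
    by rewrite mdegE big1 // => a _; apply/eqP.
  by exists a, (w - U_(a))%MM; rewrite addmC submK // lep1mP.
have w'e : mdeg w' = e by move: we; rewrite wE mdegD mdeg1 => -[].
rewrite wE mpolyXD.
have -> : 'X_a * 'X_[w'] - \sum_i ('X_a * 'X_[w']).@[P i] *: ('X_(j i) * v i) =
    'X_a * ('X_[w'] - \sum_i ('X_[w']).@[P i] *: v i) +
    \sum_i ('X_[w']).@[P i] *: ('X_a * v i - P i a *: ('X_(j i) * v i)).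
  rewrite mulrBr -addrA; congr (_ + _); rewrite mulr_sumr -sumrN -sumrN -big_split.
  apply: eq_bigr => i _ /=; rewrite mevalM mevalXU scalerBr scalerA -scalerAr.
  by rewrite addrA addNr add0r mulrC.
apply: in_spanD; first exact/in_spanM/vI.
by apply: in_span_sum => i _; apply/in_spanZ/vL.
Qed.

Lemma interpolates_vanishing e v y : interpolates e v -> y \is e.-homog ->
  (forall i, y.@[P i] = 0) -> in_span g y.
Proof.
move=> vI hy y0.
have -> : y = \sum_(w <- msupp y) y@_w *:
    ('X_[w] - \sum_i ('X_[w]).@[P i] *: v i).
  under eq_bigr do rewrite scalerBr.
  rewrite sumrB -mpolyE -[LHS]subr0; congr (_ - _); apply/esym.
  under eq_bigr do rewrite scaler_sumr.
  rewrite exchange_big big1 // => i _ /=; under eq_bigr do rewrite scalerA.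
  rewrite -scaler_suml; suff -> : \sum_(w <- msupp y) y@_w * ('X_[w]).@[P i] = 0.
    by rewrite scale0r.
  rewrite -[RHS](y0 i) [in RHS](mpolyE y) meval_sum; apply: eq_bigr => w _.
  by rewrite mevalZ.
rewrite big_seq; apply: in_span_sum => w wy; apply: in_spanZ; apply: vI.
exact: homog_mdeg wy.
Qed.

(** Finitely many identities suffice: degrees below [n] are given, and those from [n.-1] on follow
    inductively from the localizing family [u]. *)
Lemma vanishing_in_span (u : 'I_n -> {mpoly R[N]}) (n_gt0 : (0 < n)%N) :
  (forall e, (e < n)%N -> exists v, interpolates e v) ->
  interpolates n.-1 u -> localizes u ->
  forall e y, y \is e.-homog -> (forall i, y.@[P i] = 0) -> in_span g y.
Proof.
move=> small uI uL e y; suff [v vI] : exists v, interpolates e v.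
  exact: interpolates_vanishing vI.
have [/small //|] := ltnP e n.
move/(leq_trans (leq_pred n)) => ne; rewrite -(subnK ne).
suff [v []] : exists v, interpolates (e - n.-1 + n.-1) v /\ localizes v.
  by exists v.
elim: (e - n.-1)%N => [|c [v [vI vL]]]; first by exists u.
rewrite addSn; have [vI' vL'] := interpolatesS vI vL.
by exists (fun i => 'X_(j i) * v i).
Qed.

End Interpolation.

Section InterpolationOverField.
Variables (N n s : nat) (K : fieldType).
Variables (j : 'I_n -> 'I_N) (P : 'I_n -> 'I_N -> K).
Hypothesis Pj : forall i, P i (j i) = 1.
Hypothesis P_distinct : forall i i' c, i != i' -> ~ (forall a, P i a = c * P i' a).
Variable g : 'I_s -> {mpoly K[N]}.
Hypothesis g_gen : forall d y, y \is d.-homog -> (forall i, y.@[P i] = 0) ->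
  in_span g y.

Lemma exists_interpolates e : exists v, interpolates P g e v.
Proof.
pose W : finType := 'X_{1..N < e.+1}.
pose M : 'M[K]_(#|W|, n) := \matrix_(r, i)
  (if mdeg (enum_val r : 'X_{1..N < e.+1}) == e then ('X_[enum_val r : 'X_{1..N < e.+1}]).@[P i] else 0).
pose X (r : 'I_#|W|) : {mpoly K[N]} :=
  if mdeg (enum_val r : 'X_{1..N < e.+1}) == e then 'X_[enum_val r : 'X_{1..N < e.+1}] else 0.
(* [M] evaluates the monomials of degree [e] at the points. A generalized inverse is enough, because
   [M *m pinvmx M *m M = M]; the points need not impose independent conditions in degree [e]. *)
pose v i := \sum_r pinvmx M i r *: X r.
have hX r : X r \is e.-homog.
  by rewrite /X; case: ifP => h; rewrite ?dhomogX ?dhomog0.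
have XM r i : (X r).@[P i] = M r i.
  by rewrite /X mxE; case: ifP => // _; rewrite meval0.
exists v => w we.
have we' : (mdeg w < e.+1)%N by rewrite we.
pose r := enum_rank (BMultinom we' : W).
have Xr : X r = 'X_[w] by rewrite /X enum_rankK /= we eqxx.
rewrite -Xr; apply: (g_gen (d := e)).
  rewrite rpredB // rpred_sum // => i _; rewrite rpredZ // rpred_sum // => r' _.
  by rewrite rpredZ.
move=> i; rewrite mevalB meval_sum XM.
have -> : M r i = (M *m pinvmx M *m M) r i by rewrite mulmxKpV ?submx_refl.
rewrite -mulmxA mxE -sumrB big1 // => i' _; rewrite mevalZ XM.
rewrite [(pinvmx M *m M) i' i]mxE meval_sum.
have -> : \sum_r' (pinvmx M i' r' *: X r').@[P i] =
    \sum_r' pinvmx M i' r' * M r' i.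
  by apply: eq_bigr => r' _; rewrite mevalZ XM.
by rewrite subrr.
Qed.

Lemma exists_separating_form i i' : i != i' ->
  exists L : {mpoly K[N]}, [/\ L \is 1.-homog, L.@[P i] = 1 & L.@[P i'] = 0].
Proof.
move=> ii'; have [a aP] : exists a, P i a - P i' a * P i (j i') != 0.
  apply: contrapT => no; apply: (@P_distinct i i' (P i (j i')) ii') => a.
  apply/eqP; rewrite -subr_eq0 [X in _ - X]mulrC; apply: contrapT => /negP h.
  by apply: no; exists a.
exists ((P i a - P i' a * P i (j i'))^-1 *: ('X_a - P i' a *: 'X_(j i'))).
split; first by rewrite rpredZ // rpredB ?rpredZ // dhomogX /= mdeg1.
  by rewrite mevalZ mevalB mevalZ !mevalXU mulVf.
by rewrite mevalZ mevalB mevalZ !mevalXU Pj mulr1 subrr mulr0.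
Qed.

(** Each [u i] is a product of [n.-1] linear forms, one for each other point, equal to 1 at [P i]
    and vanishing at that other point. *)
Lemma exists_separators : exists u : 'I_n -> {mpoly K[N]},
  forall i, u i \is (n.-1).-homog /\ forall i', (u i).@[P i'] = (i == i')%:R.
Proof.
have /choice [L LP] : forall x : 'I_n * 'I_n, exists L : {mpoly K[N]},
    x.1 != x.2 -> [/\ L \is 1.-homog, L.@[P x.1] = 1 & L.@[P x.2] = 0].
  move=> [i i']; have [->|ii'] := eqVneq i i'; first by exists 0.
  by have [L] := exists_separating_form ii'; exists L.
exists (fun i => \prod_(i' < n | i' != i) L (i, i')) => i; split.
  have -> : (n.-1 = \sum_(i' < n | i' != i) 1)%N.
    by rewrite sum1_card cardC1 card_ord.
  elim/big_rec2: _ => [|i' y d ii' hy]; first exact: dhomog1.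
  apply: dhomogM => //; have := LP (i, i'); rewrite eq_sym => /(_ ii').
  by case.
move=> i'; rewrite meval_prod; have [<-|ii'] := eqVneq i i'.
  by rewrite big1 // => i1; rewrite eq_sym => /(LP (i, i1)) [].
rewrite (bigD1 i') ?(eq_sym i') //=.
by have [_ _ ->] := LP (i, i') ii'; rewrite mul0r.
Qed.

Lemma exists_localizing_interpolation :
  exists u, interpolates P g n.-1 u /\ localizes j P g u.
Proof.
have [u uP] := exists_separators; exists u; split=> [w wn|i a].
  apply: (g_gen (d := n.-1)).
    rewrite rpredB // ?dhomogX; first by rewrite /= wn.
    by rewrite rpred_sum // => i _; rewrite rpredZ //; case: (uP i).
  move=> i; rewrite mevalB meval_sum (bigD1 i) //= big1 => [|i' ii'].
    by rewrite mevalZ (uP i).2 eqxx mulr1 addr0 subrr.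
  by rewrite mevalZ (uP i').2 (negPf ii') mulr0.
have hu b : 'X_b * u i \is (1 + n.-1).-homog.
  by apply: dhomogM; [rewrite dhomogX /= mdeg1 | case: (uP i)].
apply: (g_gen (d := (1 + n.-1)%N)); first by apply: rpredB; [|apply: rpredZ]; apply: hu.
move=> i'; rewrite mevalB mevalZ !mevalM !mevalXU (uP i).2.
have [<-|_] := eqVneq i i'; first by rewrite Pj !mulr1 subrr.
by rewrite !mulr0 subrr.
Qed.

End InterpolationOverField.

(** * Descent to an arbitrary field *)

Section MapPoly.
Variables (N : nat) (A B : comNzRingType) (f : {rmorphism A -> B}).
Implicit Types y : {mpoly A[N]}.

Lemma map_mpoly_sum (I : Type) (r : seq I) (Q : pred I)
    (G : I -> {mpoly A[N]}) :
  map_mpoly f (\sum_(i <- r | Q i) G i) =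
  \sum_(i <- r | Q i) map_mpoly f (G i).
Proof. exact: raddf_sum. Qed.

Lemma map_mpoly_meval y (v : 'I_N -> A) :
  f y.@[v] = (map_mpoly f y).@[fun i => f (v i)].
Proof.
rewrite {1 2}[y]mpolyE meval_sum rmorph_sum map_mpoly_sum meval_sum.
apply: eq_bigr => m _; rewrite map_mpolyZ map_mpolyX !mevalZ !mevalX rmorphM.
by rewrite rmorph_prod; congr (_ * _); apply: eq_bigr => i _; rewrite rmorphXn.
Qed.

Lemma map_mpoly_shift (j : 'I_N) (P : 'I_N -> A) y :
  map_mpoly f (shift j P y) = shift j (fun i => f (P i)) (map_mpoly f y).
Proof.
rewrite shiftE [in RHS](mpolyE y) !map_mpoly_sum [RHS]rmorph_sum.
apply: eq_bigr => m _; rewrite [in RHS]map_mpolyZ map_mpolyX [RHS]shiftZ.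
rewrite map_mpolyZ !shiftX rmorph_prod; congr (_ *: _).
apply: eq_bigr => i _; rewrite rmorphXn /=; congr (_ ^+ _).
by case: ifP => _; rewrite ?rmorphD /= ?map_mpolyZ !map_mpolyX.
Qed.

End MapPoly.

Section Transfer.
Variables (N : nat) (A K F : comNzRingType).
Variables (iota : {rmorphism A -> K}) (phi : {rmorphism A -> F}).
Hypothesis ker_iota : forall x, iota x = 0 -> phi x = 0.
Implicit Types y : {mpoly A[N]}.

Lemma transfer_coeff y m : (map_mpoly iota y)@_m = 0 -> (map_mpoly phi y)@_m = 0.
Proof. by rewrite !mcoeff_map_mpoly => /ker_iota. Qed.

Lemma transfer_eq0 y : map_mpoly iota y = 0 -> map_mpoly phi y = 0.
Proof.
move=> y0; apply/mpolyP => m; rewrite mcoeff0.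
by apply: transfer_coeff; rewrite y0 mcoeff0.
Qed.

Lemma transfer_msupp y : {subset msupp (map_mpoly phi y) <= msupp (map_mpoly iota y)}.
Proof. by move=> m; rewrite !mcoeff_msupp; apply: contraNneq => /transfer_coeff ->. Qed.

Lemma transfer_homog y d : map_mpoly iota y \is d.-homog ->
  map_mpoly phi y \is d.-homog.
Proof. by move/dhomogP => H; apply/dhomogP => m /transfer_msupp /H. Qed.

Lemma transfer_vanishing (j : 'I_N) k y :
  vanishing_order j k (map_mpoly iota y) -> vanishing_order j k (map_mpoly phi y).
Proof. by move=> H m /transfer_msupp /H. Qed.

End Transfer.

Lemma exists_specialization_mpoly (N : nat) (K : fieldType)
    (L : seq {mpoly K[N]}) :
  exists (l : nat) (F : closedFieldType) (A : comNzRingType)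
    (iota : {rmorphism A -> K}) (phi : {rmorphism A -> F}),
    [/\ l \in [pchar F], forall x, iota x = 0 -> phi x = 0 &
        forall y, y \in L -> exists z, map_mpoly iota z = y].
Proof.
have [l [F [A [iota [phi [lF ker im]]]]]] :=
  exists_specialization (flatten [seq [seq y@_m | m <- msupp y] | y <- L]).
exists l, F, A, iota, phi; split=> // y yL.
have /choice [z zE] : forall m, exists z, iota z = y@_m.
  move=> m; have [my|/memN_msupp_eq0 ->] := boolP (m \in msupp y).
    apply: im; apply/flattenP; exists [seq y@_m | m <- msupp y].
      by apply/mapP; exists y.
    by apply/mapP; exists m.
  by exists 0; rewrite rmorph0.
exists (\sum_(m <- msupp y) z m *: 'X_[m]); rewrite [RHS]mpolyE rmorph_sum /=.
by apply: eq_bigr => m _; rewrite map_mpolyZ map_mpolyX zE.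
Qed.

Section Descent.
Variables (K : fieldType) (n s alpha : nat).
Hypothesis n_gt0 : (0 < n)%N.
Variables (j : 'I_n -> 'I_3) (P : 'I_n -> 'I_3 -> K).
Hypothesis Pj : forall i, P i (j i) = 1.
Hypothesis P_distinct :
  forall i i' c, i != i' -> ~ (forall a, P i a = c * P i' a).
Variable g : 'I_s -> {mpoly K[3]}.
Hypothesis g_homog : forall b, g b \is alpha.-homog.
Hypothesis g_vanish : forall b i, (g b).@[P i] = 0.
Hypothesis g_gen : forall d y, y \is d.-homog -> (forall i, y.@[P i] = 0) ->
  in_span g y.
Variables (f : {mpoly K[3]}) (d k : nat).
Hypothesis k_gt0 : (0 < k)%N.
Hypothesis f_homog : f \is d.-homog.
Hypothesis f_vanish :
  forall i, vanishing_order (j i) (2 * k) (shift (j i) (P i) f).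

(** The hypotheses are certified by finitely many polynomials, so all of them can be specialized at
    once. The list [S] lets the caller also lift the elements needed to bring a conclusion back to
    [K]. *)
Lemma specialized_containment (S : seq {mpoly K[3]}) :
  exists (F : closedFieldType) (A : comNzRingType)
    (iota : {rmorphism A -> K}) (phi : {rmorphism A -> F})
    (f' : {mpoly A[3]}) (g' : 'I_s -> {mpoly A[3]}),
    [/\ forall x, iota x = 0 -> phi x = 0,
        forall y, y \in S -> exists z, map_mpoly iota z = y,
        map_mpoly iota f' = f /\ (forall b, map_mpoly iota (g' b) = g b),
        map_mpoly phi f' != 0 -> (k * alpha.+1 <= d)%N &
        exists h : {ffun 'I_k -> 'I_s} -> {mpoly F[3]}, map_mpoly phi f' =
          \sum_t h t * \prod_(i < k) map_mpoly phi (g' (t i))].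
Proof.
pose W : finType := 'X_{1..3 < n}.
have /choice [v0 v0I] := exists_interpolates g_gen.
have [u [uI uL]] := exists_localizing_interpolation Pj P_distinct g_gen.
have /choice [h1 h1E] : forall w : W, exists h : 'I_s -> {mpoly K[3]},
    'X_[w] - \sum_i ('X_[w]).@[P i] *: v0 (mdeg w) i = \sum_b h b * g b.
  by move=> w; apply: v0I.
have /choice [h2 h2E] : forall w : W, exists h : 'I_s -> {mpoly K[3]},
    mdeg w = n.-1 ->
    'X_[w] - \sum_i ('X_[w]).@[P i] *: u i = \sum_b h b * g b.
  move=> w; have [wn|wn] := eqVneq (mdeg w) n.-1.
    by have [h hE] := uI w wn; exists h.
  by exists (fun=> 0) => wn'; rewrite wn' eqxx in wn.
have /choice [h3 h3E] : forall x : 'I_n * 'I_3, exists h : 'I_s -> {mpoly K[3]},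
    'X_(x.2) * u x.1 - P x.1 x.2 *: ('X_(j x.1) * u x.1) = \sum_b h b * g b.
  by move=> x; apply: uL.
pose L := [:: f] ++ S ++ codom g ++ codom u ++
  codom (fun x : 'I_n * 'I_3 => (P x.1 x.2)%:MP) ++
  codom (fun x : 'I_n * 'I_n => v0 x.1 x.2) ++
  codom (fun x : W * 'I_s => h1 x.1 x.2) ++
  codom (fun x : W * 'I_s => h2 x.1 x.2) ++
  codom (fun x : ('I_n * 'I_3) * 'I_s => h3 x.1 x.2).
have [l [F [A [iota [phi [lF ker lift]]]]]] := exists_specialization_mpoly L.
have lift1 (T : finType) (G : T -> {mpoly K[3]}) : {subset codom G <= L} ->
    exists G' : T -> {mpoly A[3]}, forall x, map_mpoly iota (G' x) = G x.
  move=> GL; have /choice [G' G'E] : forall x, exists z, map_mpoly iota z = G x.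
    by move=> x; apply/lift/GL/codom_f.
  by exists G'.
have [f' fE] := lift f (mem_head _ _).
have [g' gE] : exists G', forall x, map_mpoly iota (G' x) = g x.
  by apply: lift1 => y yc; rewrite !mem_cat yc !orbT.
have [u' uE] : exists G', forall x, map_mpoly iota (G' x) = u x.
  by apply: lift1 => y yc; rewrite !mem_cat yc !orbT.
have [Q QE] := lift1 _ (fun x : 'I_n * 'I_3 => (P x.1 x.2)%:MP)
  ltac:(by move=> y yc; rewrite !mem_cat yc !orbT).
have [v' vE] := lift1 _ (fun x : 'I_n * 'I_n => v0 x.1 x.2)
  ltac:(by move=> y yc; rewrite !mem_cat yc !orbT).
have [h1' h1'E] := lift1 _ (fun x : W * 'I_s => h1 x.1 x.2)
  ltac:(by move=> y yc; rewrite !mem_cat yc !orbT).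
have [h2' h2'E] := lift1 _ (fun x : W * 'I_s => h2 x.1 x.2)
  ltac:(by move=> y yc; rewrite !mem_cat yc !orbT).
have [h3' h3'E] := lift1 _ (fun x : ('I_n * 'I_3) * 'I_s => h3 x.1 x.2)
  ltac:(by move=> y yc; rewrite !mem_cat yc !orbT).
pose P' i a := (Q (i, a))@_0%MM.
have PE i a : iota (P' i a) = P i a.
  by rewrite -mcoeff_map_mpoly QE mcoeffC eqxx mulr1.
have PE' i : (fun a => iota (P' i a)) = P i by apply: funext => a; apply: PE.
pose PF i a := phi (P' i a).
have PFj i : PF i (j i) = 1.
  apply/eqP; rewrite -subr_eq0 /PF -(rmorph1 phi) -rmorphB; apply/eqP/ker.
  by rewrite rmorphB PE Pj rmorph1 subrr.
(* The lifted identities hold only after [iota]. Written as the vanishing of a polynomial over [A],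
   they pass to [F] by the inclusion of kernels. *)
pose rel (R : comNzRingType) (p : 'I_n -> 'I_3 -> R)
    (v : 'I_n -> {mpoly R[3]}) (h gg : 'I_s -> {mpoly R[3]}) (w : 'X_{1..3}) :=
  'X_[w] - \sum_i ('X_[w]).@[p i] *: v i - \sum_b h b * gg b.
have map_rel (B : comNzRingType) (psi : {rmorphism A -> B}) p v h gg w :
    map_mpoly psi (rel A p v h gg w) =
    rel B (fun i a => psi (p i a)) (fun i => map_mpoly psi (v i))
      (fun b => map_mpoly psi (h b)) (fun b => map_mpoly psi (gg b)) w.
  rewrite !rmorphB !rmorph_sum /= map_mpolyX; congr (_ - _ - _).
    apply: eq_bigr => i _.
    by rewrite map_mpolyZ map_mpoly_meval map_mpolyX.
  by apply: eq_bigr => b _; rewrite rmorphM.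
pose gF b := map_mpoly phi (g' b).
have transfer_rel v h (v1 : 'I_n -> {mpoly K[3]}) (k1 : 'I_s -> {mpoly K[3]})
    w : (forall i, map_mpoly iota (v i) = v1 i) ->
    (forall b, map_mpoly iota (h b) = k1 b) ->
    'X_[w] - \sum_i ('X_[w]).@[P i] *: v1 i = \sum_b k1 b * g b ->
    in_span gF ('X_[w] - \sum_i ('X_[w]).@[PF i] *: map_mpoly phi (v i)).
  move=> vv1 hh1 E; exists (fun b => map_mpoly phi (h b)).
  apply/eqP; rewrite -subr_eq0; apply/eqP.
  have := @map_rel F phi P' v h g' w; rewrite /rel => <-.
  apply: (transfer_eq0 ker); rewrite [LHS]map_rel /rel; apply/eqP.
  rewrite subr_eq0; apply/eqP.
  under eq_bigr do rewrite PE' vv1.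
  by rewrite E; apply: eq_bigr => b _; rewrite hh1 gE.
have gF_gen : forall e y, y \is e.-homog -> (forall i, y.@[PF i] = 0) ->
    in_span gF y.
  apply: (@vanishing_in_span _ _ _ _ j PF gF (fun i => map_mpoly phi (u' i)) n_gt0).
  - move=> e en; exists (fun i => map_mpoly phi (v' (Ordinal en, i))) => w we.
    have wn : (mdeg w < n)%N by rewrite we.
    apply: (transfer_rel _ (fun b => h1' (BMultinom wn : W, b)) _ _ w
      (fun i => vE (Ordinal en, i)) (fun b => h1'E (_, b))).
    by have := h1E (BMultinom wn); rewrite /= we.
  - move=> w we; have wn : (mdeg w < n)%N by rewrite we prednK.
    apply: (transfer_rel _ (fun b => h2' (BMultinom wn : W, b)) _ _ w
      uE (fun b => h2'E (_, b))).
    exact: h2E (BMultinom wn) we.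
  - move=> i a; exists (fun b => map_mpoly phi (h3' ((i, a), b))).
    apply/eqP; rewrite -subr_eq0; apply/eqP.
    have mE (B : comNzRingType) (psi : {rmorphism A -> B}) :
        map_mpoly psi ('X_a * u' i - P' i a *: ('X_(j i) * u' i) -
                       \sum_b h3' ((i, a), b) * g' b) =
        'X_a * map_mpoly psi (u' i) -
        psi (P' i a) *: ('X_(j i) * map_mpoly psi (u' i)) -
        \sum_b map_mpoly psi (h3' ((i, a), b)) * map_mpoly psi (g' b).
      rewrite !rmorphB rmorph_sum /= map_mpolyZ !rmorphM /= !map_mpolyX.
      by congr (_ - _); apply: eq_bigr => b _; rewrite rmorphM.
    rewrite -[LHS]mE; apply: (transfer_eq0 ker); rewrite mE uE PE.
    rewrite (h3E (i, a)) -sumrB big1 // => b _.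
    by rewrite gE h3'E subrr.
have gF_homog b : gF b \is alpha.-homog.
  by apply: (transfer_homog ker); rewrite gE.
have gF_vanish b i : (gF b).@[PF i] = 0.
  by rewrite -map_mpoly_meval ker // map_mpoly_meval gE PE'.
have fF_homog : map_mpoly phi f' \is d.-homog.
  by apply: (transfer_homog ker); rewrite fE.
have fF_vanish i :
    vanishing_order (j i) (2 * k) (shift (j i) (PF i) (map_mpoly phi f')).
  rewrite -map_mpoly_shift; apply: (transfer_vanishing ker).
  by rewrite map_mpoly_shift fE PE'.
exists F, A, iota, phi, f', g'; split=> //.
- by move=> y yS; apply: lift; rewrite !mem_cat yS !orbT.
- exact: (symbolic_degree lF n_gt0 PFj gF_homog gF_vanish gF_gen k_gt0 fF_homog
    fF_vanish).
- exact: (symbolic_in_power lF PFj gF_homog gF_vanish gF_gen k_gt0 fF_homog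
    fF_vanish).
Qed.

(** Lifting the inverse of the leading coefficient along with [f] makes that coefficient invertible
    in [F], so [f] stays nonzero there. *)
Lemma symbolic_degree_field : f != 0 -> (k * alpha.+1 <= d)%N.
Proof.
move=> fn0; pose m := mlead f; have fm : f@_m != 0 by rewrite mleadc_eq0.
have [F [A [iota [phi [f' [g' [ker lift [fE _] deg _]]]]]]] :=
  specialized_containment [:: (f@_m)^-1%:MP].
have [z zE] := lift _ (mem_head _ _).
apply: deg; apply/eqP => fF0; have /eqP := oner_neq0 F; apply.
rewrite -(rmorph1 phi) -[RHS](mul0r (phi (z@_0%MM))).
have <- : phi (f'@_m) = 0 by rewrite -mcoeff_map_mpoly fF0 mcoeff0.
apply/eqP; rewrite -rmorphM -subr_eq0 -rmorphB; apply/eqP/ker.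
rewrite rmorphB rmorphM rmorph1 -!mcoeff_map_mpoly zE fE mcoeffC eqxx mulr1.
by rewrite mulfV // subrr.
Qed.

Lemma symbolic_in_power_field :
  exists h : {ffun 'I_k -> 'I_s} -> {mpoly K[3]},
    f = \sum_t h t * \prod_(i < k) g (t i).
Proof.
pose W : finType := 'X_{1..3 < d.+1}; pose T : finType := {ffun 'I_k -> 'I_s}.
pose X : finType := (W * T)%type.
pose pr (t : T) : {mpoly K[3]} := \prod_(i < k) g (t i).
pose Y (x : X) : {mpoly K[3]} := 'X_[x.1] * pr x.2.
(* The rows span the degree [d] part of the ideal generated by the products of [k] generators; rows
   of any other degree are set to zero. *)
pose M : 'M[K]_(#|X|, #|W|) := \matrix_(r, c)
  (if (mdeg (enum_val r : X).1 + alpha * k == d)%N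
   then (Y (enum_val r))@_(enum_val c : W) else 0).
pose fv : 'rV[K]_#|W| := \row_c f@_(enum_val c : W).
have fW : f = \sum_(w : W) f@_w *: 'X_[w].
  apply: mpolywE; rewrite msizeE; apply/bigmax_leqP_seq => m mf _.
  by rewrite (homog_mdeg f_homog mf).
have [/submxP [x xE]|] := boolP (fv <= M)%MS.
  pose c (p : X) := if (mdeg p.1 + alpha * k == d)%N
    then x 0 (enum_rank p) else 0.
  exists (fun t => \sum_(w : W) c (w, t) *: 'X_[w]).
  have fE (w : W) : f@_w = (\sum_(p : X) c p *: Y p)@_w.
    have := congr1 (fun A : 'rV[K]_#|W| => A 0 (enum_rank w)) xE.
    rewrite !mxE enum_rankK => ->; rewrite raddf_sum /=.
    rewrite [RHS](reindex_onto (@enum_val X X) (@enum_rank X)) /=; last first.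
      by move=> p _; rewrite enum_rankK.
    apply: eq_big => [r|r _]; first by rewrite enum_valK eqxx.
    rewrite mcoeffZ /c mxE enum_rankK enum_valK.
    by case: ifP => _; rewrite ?mulr0 ?mul0r.
  have -> : f = \sum_(p : X) c p *: Y p.
    apply/mpolyP => m; have [md|md] := ltnP (mdeg m) d.+1.
      exact: (fE (BMultinom md)).
    rewrite (dhomog_nemf_coeff f_homog) ?gtn_eqF // raddf_sum big1 //= => p _.
    rewrite mcoeffZ /c; case: eqP => [pd|_]; last by rewrite mul0r.
    rewrite (@dhomog_nemf_coeff _ _ mdeg d) ?mulr0 ?gtn_eqF // -pd.
    by apply: dhomogM; [rewrite dhomogX | apply: dhomog_prod_ord].
  have -> : \sum_(p : X) c p *: Y p = \sum_w \sum_t c (w, t) *: Y (w, t).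
    by rewrite pair_big /=; apply: eq_bigr => -[w t] _.
  rewrite exchange_big; apply: eq_bigr => t _; rewrite mulr_suml.
  by apply: eq_bigr => w _; rewrite scalerAl.
rewrite submxE => ne.
have [z zn0] : exists z, (fv *m cokermx M) 0 z != 0.
  apply: contrapT => no; move/eqP: ne; apply; apply/rowP => z; rewrite [RHS]mxE.
  by apply/eqP; apply: contrapT => /negP h; apply: no; exists z.
(* A column of the cokernel not killing [f], normalized to a functional that is 1 on [f] and zero on
   the rows of [M]. Both equations survive specialization and contradict the expansion over [F]. *)
pose lam (w : W) := cokermx M (enum_rank w) z / (fv *m cokermx M) 0 z.
have lam_sum (G : W -> K) (v : 'rV[K]_#|W|) :
    (forall w, v 0 (enum_rank w) = G w) ->
    \sum_w G w * lam w = (v *m cokermx M) 0 z / (fv *m cokermx M) 0 z.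
  move=> vG; rewrite mxE mulr_suml.
  rewrite [RHS](reindex_onto (@enum_rank W) (@enum_val W W)) /=; last first.
    by move=> w _; rewrite enum_valK.
  apply: eq_big => [w|w _]; first by rewrite enum_rankK eqxx.
  by rewrite vG /lam mulrA.
have [F [A [iota [phi [f' [g' [ker lift [fE gE] _ [h hE]]]]]]]] :=
  specialized_containment (codom (fun w : W => (lam w)%:MP)).
have /choice [lam' lam'E] : forall w : W, exists x, iota x = lam w.
  move=> w; have [y yE] := lift _ (codom_f _ w).
  by exists (y@_0%MM); rewrite -mcoeff_map_mpoly yE mcoeffC eqxx mulr1.
pose ev (y : {mpoly F[3]}) := \sum_(w : W | mdeg w == d) y@_w * phi (lam' w).
have ev_sum (I : finType) (G : I -> {mpoly F[3]}) :
    ev (\sum_i G i) = \sum_i ev (G i).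
  rewrite /ev exchange_big; apply: eq_bigr => w _.
  by rewrite raddf_sum mulr_suml.
have ev_map (y : {mpoly A[3]}) :
    \sum_(w : W | mdeg w == d) (map_mpoly iota y)@_w * lam w = 0 ->
    ev (map_mpoly phi y) = 0.
  move=> y0; have <- : phi (\sum_(w : W | mdeg w == d) y@_w * lam' w) = 0.
    apply: ker; rewrite rmorph_sum -[RHS]y0; apply: eq_bigr => w _.
    by rewrite rmorphM lam'E mcoeff_map_mpoly.
  by rewrite rmorph_sum; apply: eq_bigr => w _; rewrite rmorphM mcoeff_map_mpoly.
suff : ev (map_mpoly phi f') = 1.
  move/eqP; rewrite hE ev_sum big1 ?(eq_sym 0) ?oner_eq0 // => t _.
  (* The coefficients [h t] need not be homogeneous: they are split into monomials, and products of
     degree other than [d] are invisible to [ev]. *)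
  rewrite [h t]mpolyE big_tnth mulr_suml ev_sum big1 // => i _.
  set u := tnth _ i; rewrite -scalerAl.
  have -> (c : F) y : ev (c *: y) = c * ev y.
    by rewrite /ev mulr_sumr; apply: eq_bigr => w _; rewrite mcoeffZ mulrA.
  have gF_homog b : map_mpoly phi (g' b) \is alpha.-homog.
    by apply: (transfer_homog ker); rewrite gE.
  have [ud|ud] := eqVneq (mdeg u + alpha * k)%N d; last first.
    rewrite /ev big1 ?mulr0 // => w /eqP wd.
    rewrite (@dhomog_nemf_coeff _ _ mdeg (mdeg u + alpha * k)) ?mul0r //.
      apply: dhomogM; first by rewrite dhomogX.
      exact: dhomog_prod_ord.
    by rewrite /= wd eq_sym.
  have uW : (mdeg u < d.+1)%N by rewrite ltnS -ud leq_addr.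
  have -> : 'X_[u] * \prod_(i < k) map_mpoly phi (g' (t i)) =
      map_mpoly phi ('X_[u] * \prod_(i < k) g' (t i)).
    by rewrite rmorphM rmorph_prod /= map_mpolyX.
  rewrite ev_map ?mulr0 // rmorphM rmorph_prod /= map_mpolyX.
  under [X in 'X_[u] * X]eq_bigr do rewrite gE.
  pose r : 'I_#|X| := enum_rank ((BMultinom uW : W, t) : X).
  rewrite big_mkcond /=.
  transitivity (\sum_(w : W) M r (enum_rank w) * lam w).
    apply: eq_bigr => w _; rewrite mxE !enum_rankK /= ud eqxx.
    case: eqP => // /eqP wd.
    have : 'X_[u] * pr t \is (mdeg u + alpha * k).-homog.
      by apply: dhomogM; [rewrite dhomogX | apply: dhomog_prod_ord].
    by rewrite ud => hY; rewrite (dhomog_nemf_coeff hY wd) mul0r.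
  rewrite (lam_sum _ (row r M)) => [|w]; last by rewrite mxE.
  by rewrite -row_mul mulmx_coker row0 mxE mul0r.
have <- : phi 1 = 1 by rewrite rmorph1.
have evf : iota (\sum_(w : W | mdeg w == d) f'@_w * lam' w) = 1.
  rewrite rmorph_sum -[RHS](mulfV zn0) -(lam_sum (fun w => f@_w) fv) => [|w].
    rewrite big_mkcond; apply: eq_bigr => w _ /=; rewrite rmorphM lam'E /=.
    rewrite -mcoeff_map_mpoly fE; case: eqP => // /eqP wd.
    by rewrite (dhomog_nemf_coeff f_homog wd) mul0r.
  by rewrite mxE enum_rankK.
apply/eqP; rewrite -subr_eq0.
have -> : ev (map_mpoly phi f') = phi (\sum_(w : W | mdeg w == d) f'@_w * lam' w).
  by rewrite rmorph_sum; apply: eq_bigr => w _; rewrite rmorphM mcoeff_map_mpoly.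
by rewrite -rmorphB; apply/eqP/ker; rewrite rmorphB evf rmorph1 subrr.
Qed.

End Descent.

(** * Ideals of points *)

Section IdealLemmas.
Variable R : comNzRingType.
Implicit Types (A B G : set R).

Lemma ideal_gen_sub A G : is_ideal A -> G `<=` A -> ideal_gen G `<=` A.
Proof. by move=> iA GA; apply: smallest_sub. Qed.

Lemma ideal_gen_mem G x : G x -> ideal_gen G x.
Proof. by move=> Gx A [_ GA]; apply: GA. Qed.

Lemma ideal_gen_ideal G : is_ideal (ideal_gen G).
Proof.
split=> [A [[]]//|x y Gx Gy A AG|x y Gy A AG].
  by case: (AG) => -[_ AD _] _; apply: AD; [apply: Gx | apply: Gy].
by case: (AG) => -[_ _ AM] _; apply: AM; apply: Gy.
Qed.

Lemma ideal_sum A (I : Type) (r : seq I) (P : pred I) (F : I -> R) :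
  is_ideal A -> (forall i, P i -> A (F i)) -> A (\sum_(i <- r | P i) F i).
Proof.
move=> [A0 AD _] AF; elim/big_rec: _ => [//|i x Pi Ax].
by apply: AD => //; apply: AF.
Qed.

Lemma ideal_mul_mem A B x y : A x -> B y -> ideal_mul A B (x * y).
Proof. by move=> Ax By; apply: ideal_gen_mem; exists x => //; exists y. Qed.

Lemma ideal_exp_ideal A k : is_ideal (ideal_exp A k).
Proof. by case: k => [|k]; [|exact: ideal_gen_ideal]. Qed.

Lemma ideal_exp_prod A k (c : nat -> R) :
  (forall i, A (c i)) -> ideal_exp A k (\prod_(0 <= i < k) c i).
Proof.
elim: k c => [//|k IH] c Ac; rewrite big_nat_recl //.
by apply: ideal_mul_mem => //; apply: (IH (fun i => c i.+1)).
Qed.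

End IdealLemmas.

Lemma ideal_exp_irrelevant (K : fieldType) (N r e : nat) (h : {mpoly K[N]}) :
  (r <= e)%N -> h \is e.-homog -> ideal_exp (irrelevant_ideal K N) r h.
Proof.
move=> re hh; rewrite [h]mpolyE big_seq; apply: ideal_sum.
  exact: ideal_exp_ideal.
move=> w /(homog_mdeg hh) we; rewrite -mul_mpolyC.
have [_ _ AM] := ideal_exp_ideal (irrelevant_ideal K N) r; apply: AM.
elim: r w e re we {hh} => [//|r IH] w e re we.
have [a wa] : exists a, w a != 0%N.
  apply: contrapT => no; move: re; rewrite -we mdegE big1 // => a _.
  by apply/eqP; apply: contrapT => /negP h0; apply: no; exists a.
have -> : w = (U_(a) + (w - U_(a)))%MM by rewrite addmC submK // lep1mP.
rewrite mpolyXD; apply: ideal_mul_mem.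
  by apply: ideal_gen_mem; exists a.
apply: (IH _ e.-1); first by case: e re we.
have := congr1 (@mdeg N) (submK (_ : (U_(a) <= w)%MM)).
rewrite lep1mP => /(_ wa); rewrite mdegD mdeg1 addn1 => E.
by rewrite -we -E.
Qed.

Lemma pihomogM (N : nat) (R : comNzRingType) (e c : nat) (h z : {mpoly R[N]}) :
  z \is c.-homog ->
  pihomog mdeg (e + c) (h * z) = pihomog mdeg e h * z.
Proof.
move=> hz; rewrite {1 2}[h]mpolyE mulr_suml !raddf_sum /= mulr_suml.
apply: eq_bigr => m _; rewrite -scalerAl !linearZ /= -scalerAl; congr (_ *: _).
have hm : 'X_[m] * z \is (mdeg m + c).-homog.
  by apply: dhomogM => //; rewrite dhomogX.
rewrite pihomogX; have [me|me] := eqVneq (mdeg m) e.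
  by rewrite pihomog_dE // -me.
by rewrite mul0r (pihomog_ne0 _ hm) // eqn_add2r.
Qed.

(** The shift preserves degrees, so a monomial of the shifted component of degree [d] has the same
    coefficient in the shift of [f]. *)
Lemma shift_pihomog_vanishing (N : nat) (R : comNzRingType) (j : 'I_N)
    (P : 'I_N -> R) (k d : nat) (f : {mpoly R[N]}) :
  vanishing_order j k (shift j P f) ->
  vanishing_order j k (shift j P (pihomog mdeg d f)).
Proof.
move=> vf m mf; apply: vf; move: (mf); rewrite !mcoeff_msupp.
have hE e : shift j P (pihomog mdeg e f) \is e.-homog.
  by apply: shift_homog; apply: pihomogP.
have md := homog_mdeg (hE d) mf.
pose B := maxn (msize f) d.+1; have dB : (d < B)%N by rewrite leq_max leqnn orbT.
have fE := pihomog_partitionE (leq_maxl (msize f) d.+1 : (mmeasure mdeg f <= B)%N).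
suff -> : (shift j P f)@_m = (shift j P (pihomog mdeg d f))@_m by [].
rewrite [in LHS]fE rmorph_sum raddf_sum (bigD1 (Ordinal dB)) //=.
rewrite big1 ?addr0 // => e ed; apply: (dhomog_nemf_coeff (hE e)).
by rewrite /= md; apply: contraNneq ed => de; apply/eqP/val_inj.
Qed.

(** A finite family in [S] whose span has maximal dimension cannot be enlarged. *)
Lemma finite_spanning_family (K : fieldType) (V : vectType K) (S : V -> Prop) :
  exists X : seq V, (forall x, x \in X -> S x) /\
                    forall x, S x -> x \in <<X>>%VS.
Proof.
have [X XS maxX] : exists2 X : seq V, (forall x, x \in X -> S x) &
    forall Y : seq V, (forall x, x \in Y -> S x) ->
      (\dim {:V} - \dim <<X>> <= \dim {:V} - \dim <<Y>>)%N.
  by apply: minimal_witness; exists [::].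
exists X; split=> // x Sx; apply: contrapT => /negP xX.
have : (\dim <<X>> < \dim <<x :: X>>)%N.
  rewrite ltn_neqAle dimvS ?andbT; last by rewrite span_cons addvSr.
  apply: contra xX => /eqP dX.
  have -> : <<X>>%VS = <<x :: X>>%VS.
    by apply/eqP; rewrite eqEdim span_cons addvSr -span_cons dX leqnn.
  by apply: memv_span; rewrite mem_head.
have := dimvS (subvf <<x :: X>>%VS); have := maxX (x :: X).
move=> /(_ _) H; have {}H := H _; move: H.
have SX : forall y, y \in x :: X -> S y.
  by move=> y; rewrite inE => /orP [/eqP ->|/XS].
by move=> /(_ SX); lia.
Qed.

Lemma prod_ord_nat (R : comNzRingType) (k : nat) (F : 'I_k -> R) :
  exists2 c : nat -> R, \prod_(i < k) F i = \prod_(0 <= i < k) c i &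
    forall i, c i = 0 \/ exists b, c i = F b.
Proof.
(* Indexing by all of [nat] allows the product to be cut into blocks; the default 0 lies in every
   ideal. *)
exists (fun i => if insub i is Some b then F b else 0).
  by rewrite big_mkord; apply: eq_bigr => i _; rewrite valK.
by move=> i; case: insubP => [b _ _|_]; [right; exists b | left].
Qed.

Section Points.
Variables (K : fieldType) (n : nat) (p : 'I_n -> 'rV[K]_3).
Hypothesis p_neq0 : forall i, p i != 0.
Hypothesis p_distinct : forall i i', i != i' -> ~ same_point (p i) (p i').

Lemma exists_normalization : exists (j : 'I_n -> 'I_3),
  forall i, p i ord0 (j i) != 0.
Proof.
have /choice [j jP] : forall i, exists a, p i ord0 a != 0.
  by move=> i; apply/rV0Pn.
by exists j.
Qed.

Variable j : 'I_n -> 'I_3.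
Hypothesis pj : forall i, p i ord0 (j i) != 0.

Definition normalized_point i (a : 'I_3) : K := p i ord0 a / p i ord0 (j i).
Local Notation P := normalized_point.

Lemma normalized_point1 i : P i (j i) = 1.
Proof. by rewrite /normalized_point mulfV. Qed.

Lemma normalized_point_distinct i i' c :
  i != i' -> ~ (forall a, P i a = c * P i' a).
Proof.
move=> ii' H; have i'i : i' != i by rewrite eq_sym.
apply: (p_distinct i'i).
have c0 : c != 0.
  apply/eqP => c0; have := H (j i).
  by rewrite normalized_point1 c0 mul0r => /eqP; rewrite oner_eq0.
exists (c * p i ord0 (j i) / p i' ord0 (j i')).
  by rewrite !mulf_neq0 ?invr_eq0.
apply/rowP => a; rewrite mxE; have := H a; rewrite /normalized_point.
move=> /(congr1 (fun x => x * p i ord0 (j i))); rewrite divfK // => ->.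
by ring.
Qed.

Lemma normalized_point_meval i d y : y \is d.-homog ->
  (y.@[P i] == 0) = (y.@[p i ord0] == 0).
Proof.
move=> hy; suff -> : y.@[p i ord0] = p i ord0 (j i) ^+ d * y.@[P i].
  by rewrite mulf_eq0 expf_eq0 (negPf (pj i)) andbF.
rewrite [y]mpolyE !meval_sum mulr_sumr big_seq [RHS]big_seq.
apply: eq_bigr => m /(homog_mdeg hy) <-; rewrite !mevalZ !mevalX mulrCA.
congr (_ * _); rewrite mdegE -prodrXr -big_split; apply: eq_bigr => a _ /=.
by rewrite -exprMn /normalized_point mulrC divfK.
Qed.

Lemma vanishing_ideal i k :
  is_ideal [set y : {mpoly K[3]} | vanishing_order (j i) k (shift (j i) (P i) y)].
Proof.
split=> [|y z vy vz|y z vz] /=.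
- by rewrite rmorph0; apply: vanishing_order0.
- by rewrite rmorphD; apply: vanishing_orderD.
- by rewrite rmorphM; apply: vanishing_orderMl.
Qed.

Lemma point_ideal_vanishing i :
  point_ideal (p i) `<=` [set y | vanishing_order (j i) 1 (shift (j i) (P i) y)].
Proof.
apply: ideal_gen_sub; first exact: vanishing_ideal.
move=> y [[d hy] /eqP]; rewrite -(normalized_point_meval i hy) => /eqP y0.
exact: meval_shift_vanishing (normalized_point1 i) hy y0.
Qed.

Lemma ideal_exp_vanishing i k :
  ideal_exp (point_ideal (p i)) k `<=`
    [set y | vanishing_order (j i) k (shift (j i) (P i) y)].
Proof.
elim: k => [//|k IH]; apply: ideal_gen_sub; first exact: vanishing_ideal.
move=> _ [y /point_ideal_vanishing vy] [z /IH vz] <- /=.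
by rewrite rmorphM; apply: (@vanishing_orderM _ _ (j i) 1 k).
Qed.

Lemma points_ideal_form d y : y \is d.-homog ->
  (forall i, y.@[P i] = 0) -> points_ideal p y.
Proof.
move=> hy y0 i _; apply: ideal_gen_mem; split; first by exists d.
by apply/eqP; rewrite -(normalized_point_meval i hy) y0.
Qed.

Lemma points_ideal_meval y i : points_ideal p y -> y.@[P i] = 0.
Proof.
move=> /(_ i I) /point_ideal_vanishing; apply: shift_vanishing_meval.
exact: normalized_point1.
Qed.

(** The given generating set may be infinite, but the forms of degree [alpha] make up a
    finite-dimensional space, so finitely many forms of the ideal span the rest. *)
Lemma exists_generating_forms alpha :
  generated_in_degree (points_ideal p) alpha ->
  exists (s : nat) (g : 'I_s -> {mpoly K[3]}),
    [/\ forall b, g b \is alpha.-homog, forall b, points_ideal p (g b) &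
        forall y, points_ideal p y -> in_span g y].
Proof.
move=> [G [hG JG]].
have [X [XJ Xspan]] := @finite_spanning_family K (dhomog 3 K alpha)
  (fun y => points_ideal p (mpoly_of_dhomog y)).
pose g (b : 'I_(size X)) : {mpoly K[3]} := mpoly_of_dhomog X`_b.
exists (size X), g; split=> [b|b|y].
- exact: dhomog_is_dhomog.
- by apply: XJ; apply: mem_nth.
rewrite JG; apply: ideal_gen_sub => [|{}y Gy].
  split; first exact: in_span0.
    by move=> u v; apply: in_spanD.
  by move=> u v; apply: in_spanM.
have yX : DHomog (hG _ Gy) \in <<in_tuple X>>%VS.
  by apply: Xspan; rewrite JG; apply: ideal_gen_mem.
have -> : y = mpoly_of_dhomog (DHomog (hG _ Gy)) by [].
rewrite (coord_span yX) raddf_sum; apply: in_span_sum => b _ /=.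
by apply: in_spanZ; apply: (in_span_gen g b).
Qed.

End Points.

(** * Assembling the containment from homogeneous components *)

Theorem proposition3p3 (K : fieldType) (N n m : nat)
    (p : 'I_n -> 'rV[K]_N.+1)
    (hn : (0 < n)%N)
    (hp0 : forall i, p i != 0)
    (hp : forall i j, i != j -> ~ same_point (p i) (p j))
    (hm : (1 <= m)%N)
    (hN : N = 2%N)
    (hJ : generated_in_degree (points_ideal p) (alpha (points_ideal p)))
    (r : nat) (hr : (1 <= r)%N) :
  let I := points_symb p m in
  let I_symb := fun k : nat => points_symb p (m * k)%N in
  I_symb (N * r)%N `<=`
    ideal_mul (ideal_exp (irrelevant_ideal K N.+1) (r * (N - 1))%N)
              (ideal_exp I r).
Proof.
subst N => I I_symb f fI; move: hJ; move: (alpha _) => d0 hJ.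
have [j pj] := exists_normalization hp0.
have [s [g [g_homog gJ gspan]]] := exists_generating_forms hJ.
pose P := normalized_point p j; pose k := (r * m)%N.
have k_gt0 : (0 < k)%N by rewrite muln_gt0 hr.
have Pj : forall i, P i (j i) = 1 := normalized_point1 pj.
have g_vanish b i : (g b).@[P i] = 0 := points_ideal_meval pj i (gJ b).
have g_gen d y : y \is d.-homog -> (forall i, y.@[P i] = 0) -> in_span g y.
  by move=> hy y0; apply: gspan; apply: points_ideal_form hy y0.
have f_vanish i : vanishing_order (j i) (2 * k) (shift (j i) (P i) f).
  have := ideal_exp_vanishing pj (fI i Logic.I).
  by rewrite /= mulnCA [(m * r)%N]mulnC.
rewrite (pihomog_partitionE (leqnn (mmeasure mdeg f))).
apply: ideal_sum => [|d _]; first exact: ideal_gen_ideal.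
set fd := pihomog mdeg d f; have hfd : fd \is (d : nat).-homog := pihomogP _ _ _.
have vfd i : vanishing_order (j i) (2 * k) (shift (j i) (P i) fd).
  exact: shift_pihomog_vanishing.
have [->|fd0] := eqVneq fd 0.
  by have [] := ideal_gen_ideal [set a * b | a in ideal_exp
    (irrelevant_ideal K 3) (r * (2 - 1)) & b in ideal_exp I r].
have distinct := normalized_point_distinct hp pj.
have deg := symbolic_degree_field hn Pj distinct g_homog g_vanish g_gen
  k_gt0 hfd vfd fd0.
have [h hE] := symbolic_in_power_field hn Pj distinct g_homog g_vanish g_gen
  k_gt0 hfd vfd.
(* Taking the part of degree [d] makes the coefficients forms of degree [d - d0 * k]. The degree
   bound makes this at least [k], hence at least [r], which provides the factor in the power of the
   irrelevant ideal. *)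
rewrite -(pihomog_dE hfd) hE raddf_sum.
apply: ideal_sum => [|t _]; first exact: ideal_gen_ideal.
have dE : (d : nat) = (d - d0 * k + d0 * k)%N.
  by rewrite subnK // mulnC (leq_trans _ deg) // leq_mul2l leqnSn orbT.
rewrite /= dE pihomogM ?dhomog_prod_ord //; apply: ideal_mul_mem.
  apply: (ideal_exp_irrelevant (e := (d - d0 * k)%N)); last exact: pihomogP.
  rewrite muln1 leq_subRL; last by rewrite dE leq_addl.
  apply: leq_trans deg; rewrite mulnS addnC mulnC leq_add2r.
  by rewrite leq_pmulr.
have [c -> cg] := prod_ord_nat (fun i : 'I_k => g (t i)).
have cJ i : points_ideal p (c i).
  case: (cg i) => [->|[b ->]]; last exact: gJ.
  by move=> i' _; case: (ideal_gen_ideal (R := {mpoly K[3]})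
    [set f | (exists d, f \is d.-homog) /\ f.@[p i' ord0] = 0]).
(* The [k = r * m] factors are cut into [r] blocks of [m]; each block lies in the [m]-th power of
   every point ideal, hence in [I]. *)
rewrite big_nat_mul.
pose c' b := \prod_(b * m <= i < b.+1 * m) c i.
apply: (@ideal_exp_prod _ _ _ c') => b i _.
rewrite /c' mulSn -{1}[(b * m)%N]add0n big_addn addnK.
apply: ideal_exp_prod => i'; exact: cJ.
Qed.
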